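(* Let $m,n\in\mathbb{N}_0$ with $n\ge m$, $\sigma,\sigma'\in(0,\infty)$, and $\theta'\in(0,\pi)$. Then \[ \int_0^\pi Q_{m-1/2}(\chi)\,\mathrm{P}^m_n(\cos\theta)\sqrt{\sin\theta}\,d\theta =2\pi(-1)^m\frac{(n-m)!}{(n+m)!}\sqrt{\sinh\sigma\sinh\sigma'\sin\theta'}\;\mathrm{P}^m_n(\cos\theta')\,P^m_n(\cosh\sigma_<)\,Q^m_n(\cosh\sigma_>), \] where \[ \chi=\frac{\cosh^2\sigma+\cosh^2\sigma'-\sin^2\theta-\sin^2\theta'-2\cosh\sigma\cosh\sigma'\cos\theta\cos\theta'}{2\sinh\sigma\sinh\sigma'\sin\theta\sin\theta'} \] and $\sigma_<=\min\{\sigma,\sigma'\}$, $\sigma_>=\max\{\sigma,\sigma'\}$.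
   Context: For $z\in\mathbb{C}\setminus(-\infty,1]$ (principal branches, $\mathbf{F}={}_2F_1/\Gamma(c)$ regularized hypergeometric function): the associated Legendre functions are $P^\mu_\nu(z)=\left(\frac{z+1}{z-1}\right)^{\mu/2}\mathbf{F}\!\left(\nu+1,-\nu;1-\mu;\frac{1-z}{2}\right)$ and $Q^\mu_\nu(z)=e^{\mu\pi i}\frac{\sqrt{\pi}\,\Gamma(\nu+\mu+1)(z^2-1)^{\mu/2}}{2^{\nu+1}z^{\nu+\mu+1}}\,\mathbf{F}\!\left(\frac{\nu+\mu}{2}+1,\frac{\nu+\mu+1}{2};\nu+\frac32;\frac{1}{z^2}\right)$, and $Q_\nu=Q^0_\nu$. $\mathrm{P}^m_n$ is the Ferrers function of the first kind: for integers $0\le m\le n$ and $x\in(-1,1)$, $\mathrm{P}^m_n(x)=(-1)^m(1-x^2)^{m/2}\frac{d^m}{dx^m}P_n(x)$ with $P_n$ the Legendre polynomial. Note $\chi\ge1$, with $\chi=1$ only when $\sigma=\sigma'$ and $\theta=\theta'$ (where $Q_{m-1/2}(\chi)$ has an integrable logarithmic singularity). *)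

(* Defs.v *)
From mathcomp Require Import all_boot all_order all_algebra.
From mathcomp Require Import all_classical all_reals all_analysis.
From mathcomp Require Import Rstruct Rstruct_topology.
From Stdlib Require Import Reals.
From Coquelicot Require Import Coquelicot.

Open Scope R_scope.

Fixpoint poch (a : R) (k : nat) : R :=
  match k with O => 1 | S k' => poch a k' * (a + INR k') end.

(** Reciprocal Gamma function at an integer j: 1/Gamma(j), equal to 0 at the
    poles j <= 0 and to 1/(j-1)! for j >= 1. *)
Definition rgamma_int (j : Z) : R :=
  if (j <=? 0)%Z then 0 else / INR (Factorial.fact (Z.to_nat (j - 1))).

(** Gamma at a half-integer: gamma_half j = Gamma(j + 1/2), j in N. *)
Fixpoint gamma_half (j : nat) : R :=
  match j with O => sqrt PI | S j' => gamma_half j' * (INR j' + /2) end.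

(** Regularized Gauss hypergeometric series
    F(a,b;c;x) = sum_k (a)_k (b)_k / (Gamma(c+k) k!) x^k,
    where the argument [rgc k] supplies 1/Gamma(c+k). *)
Definition hyp2F1reg (a b : R) (rgc : nat -> R) (x : R) : R :=
  Series (fun k => poch a k * poch b k * rgc k / INR (Factorial.fact k) * x ^ k).

(** Associated Legendre function of the first kind P^m_n(z), z > 1,
    integer degree n and order m (principal branch):
    ((z+1)/(z-1))^{m/2} F(n+1, -n; 1-m; (1-z)/2). *)
Definition legP (m n : nat) (z : R) : R :=
  sqrt ((z + 1) / (z - 1)) ^ m *
  hyp2F1reg (INR n + 1) (- INR n)
    (fun k => rgamma_int (1 - Z.of_nat m + Z.of_nat k)%Z) ((1 - z) / 2).

(** Associated Legendre function of the second kind Q^m_n(z), z > 1: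
    e^{m pi i} sqrt(pi) Gamma(n+m+1) (z^2-1)^{m/2} / (2^{n+1} z^{n+m+1})
      * F((n+m)/2+1, (n+m+1)/2; n+3/2; 1/z^2),
    with 1/Gamma(n+3/2+k) = 1/gamma_half (n+k+1). *)
Definition legQ (m n : nat) (z : R) : R :=
  (-1) ^ m * sqrt PI * INR (Factorial.fact (n + m)) * sqrt (z ^ 2 - 1) ^ m
  / (2 ^ (n + 1) * z ^ (n + m + 1))
  * hyp2F1reg ((INR n + INR m) / 2 + 1) ((INR n + INR m + 1) / 2)
      (fun k => / gamma_half (n + k + 1)) (/ z ^ 2).

(** Q_{m-1/2}(z) = Q^0_{m-1/2}(z), z > 1:
    sqrt(pi) Gamma(m+1/2) / (2^{m+1/2} z^{m+1/2})
      * F((m-1/2)/2+1, (m+1/2)/2; m+1; 1/z^2),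
    with 1/Gamma(m+1+k) = 1/(m+k)!. *)
Definition legQhalf (m : nat) (z : R) : R :=
  sqrt PI * gamma_half m / (2 ^ m * sqrt 2 * (z ^ m * sqrt z))
  * hyp2F1reg ((INR m - /2) / 2 + 1) ((INR m + /2) / 2)
      (fun k => / INR (Factorial.fact (m + k))) (/ z ^ 2).

(** Legendre polynomials (Bonnet recurrence):
    P_0 = 1, P_1 = x, (k+2) P_{k+2} = (2k+3) x P_{k+1} - (k+1) P_k. *)
Fixpoint legendre_pair (n : nat) (x : R) : R * R :=
  match n with
  | O => (1, x)
  | S n' => let (p, q) := legendre_pair n' x in
            (q, ((2 * INR n' + 3) * x * q - (INR n' + 1) * p) / (INR n' + 2))
  end.
Definition legendre (n : nat) (x : R) : R := fst (legendre_pair n x).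

Definition ferrersP (m n : nat) (x : R) : R :=
  (-1) ^ m * sqrt (1 - x ^ 2) ^ m * Derive_n (legendre n) m x.

Definition chi (s s' t t' : R) : R :=
  (cosh s ^ 2 + cosh s' ^ 2 - sin t ^ 2 - sin t' ^ 2
     - 2 * cosh s * cosh s' * cos t * cos t')
  / (2 * sinh s * sinh s' * sin t * sin t').

(* Main.v *)
Require Import Defs.
From Stdlib Require Import Reals Lra Lia Wf_nat.
From Coquelicot Require Import Coquelicot.
Open Scope R_scope.

(** With [x = cos t], [y = cos t'], [a = cosh s], [b = cosh s'], put
    [S = x^2 + y^2 + a^2 + b^2 - 2 - 2 x y a b] and
    [p = 4 (1 - x^2) (1 - y^2) (1 - a^2) (1 - b^2)]. Then [chi^2 = S^2 / p], and
    [Q_(m-1/2)(chi)] is, up to powers of the sines, the kernel [k = S^(-m-1/2) G(p / S^2)],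
    which is symmetric in the four variables; here [G] is the hypergeometric series of
    [Q_(m-1/2)]. The homogeneity of [k] in [(S, p)] and the hypergeometric equation of [G] make
    the operator [A = (1 - x^2) D^2 - 2 (m + 1) x D] act on [k] in the same way in each
    variable, and [P_n^(m)] is an eigenfunction of [A]. Green's identity therefore shows that
    [J = int_0^pi (sin t)^(2m+1) P_n^(m)(cos t) k dt] satisfies the eigenvalue equation in [b]
    and in [y]. Being regular at [b = 1] and at [y = 1], it is a multiple of
    [P_n^(m)(b) P_n^(m)(y)], with factor given by [b = y = 1], where [k] reduces to a multiple
    of [(a - x)^(-2m-1)]. Expanding that power and computing the moments of the weight by the
    same Green identity gives the series of [Q_n^m(a)]. For [s = s'] let [s'] increase to [s]:
    since [G(u) = O((1 - u)^(-1/4))], the integrands are dominated by a multiple of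
    [|t - t'|^(-1/2)]. *)

(** * Real analysis *)

(* [auto_derive], using the derivatives of unknown functions found among the hypotheses. *)
Ltac auto_derive_hyps :=
  auto_derive;
  [ repeat split; trivial; try (eexists; eassumption)
  | repeat match goal with
      | D : is_derive ?f ?x ?l |- context [Derive ?g ?x] =>
          replace (Derive g x) with l by (symmetry; now apply is_derive_unique)
      end ].

Lemma is_derive_comp_R (f g : R -> R) (x df dg : R) :
  is_derive f (g x) df -> is_derive g x dg -> is_derive (fun x => f (g x)) x (df * dg).
Proof. intros Hf Hg. rewrite Rmult_comm. now apply @is_derive_comp. Qed.

Lemma is_derive_mult_R (f g : R -> R) (x df dg : R) :
  is_derive f x df -> is_derive g x dg -> is_derive (fun x => f x * g x) x (df * g x + f x * dg).
Proof. intros Hf Hg. apply @is_derive_mult; trivial. apply Rmult_comm. Qed.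

Section ContinuityRules.
Context {T : UniformSpace}.
Implicit Types (f g : T -> R) (z : T).

Lemma continuous_comp_is_derive (h : R -> R) f z l :
  continuous f z -> is_derive h (f z) l -> continuous (fun z => h (f z)) z.
Proof.
  intros Hf Hh. apply (continuous_comp f h); trivial.
  apply @ex_derive_continuous. now exists l.
Qed.

Lemma continuous_pow_comp f z n : continuous f z -> continuous (fun z => f z ^ n) z.
Proof.
  intros Hf. apply (continuous_comp_is_derive (fun y => y ^ n) f z (INR n * f z ^ pred n)); trivial.
  auto_derive; trivial. ring.
Qed.

Lemma continuous_div f g z :
  continuous f z -> continuous g z -> g z <> 0 -> continuous (fun z => f z / g z) z.
Proof.
  intros Hf Hg Hne. apply (continuous_mult f (fun z => / g z)); trivial.
  apply (continuous_comp g Rinv); trivial. now apply continuous_Rinv.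
Qed.
End ContinuityRules.

(* Decomposes an arithmetic expression; leaves the continuity of other functions and the
   nonvanishing of denominators. *)
Ltac continuity_arith :=
  repeat lazymatch goal with
  | |- continuous (fun _ => ?c) _ => apply continuous_const
  | |- continuous (fun z => z) _ => apply continuous_id
  | |- continuous cos _ => apply continuous_cos
  | |- continuous sin _ => apply continuous_sin
  | |- continuous fst _ => apply continuous_fst
  | |- continuous (fun z => fst z) _ => apply continuous_fst
  | |- continuous (fun z => snd z) _ => apply continuous_snd
  | |- continuous (fun z => @?f z + @?g z) _ => apply (continuous_plus f g)
  | |- continuous (fun z => @?f z - @?g z) _ => apply (continuous_minus f g)
  | |- continuous (fun z => - @?f z) _ => apply (continuous_opp f)
  | |- continuous (fun z => @?f z * @?g z) _ => apply (continuous_mult f g)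
  | |- continuous (fun z => @?f z / @?g z) _ => apply (continuous_div f g)
  | |- continuous (fun z => @?f z ^ _) _ => apply (continuous_pow_comp f)
  | |- continuous (fun z => / @?f z) _ => apply (continuous_comp f Rinv); [|apply continuous_Rinv]
  | |- continuous (fun z => sqrt (@?f z)) _ =>
      apply (continuous_comp f sqrt); [|apply continuous_sqrt]
  | |- continuous (fun z => exp (@?f z)) _ => apply (continuous_comp f exp); [|apply continuous_exp]
  | |- continuous (fun z => cos (@?f z)) _ => apply (continuous_comp f cos); [|apply continuous_cos]
  | |- continuous (fun z => sin (@?f z)) _ => apply (continuous_comp f sin); [|apply continuous_sin]
  end.

Lemma continuous_segment_bounded (f : R -> R) (a b : R) : a <= b ->
  (forall t, a <= t <= b -> continuous f t) -> exists M, forall t, a <= t <= b -> Rabs (f t) <= M.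
Proof.
  intros Hab Hf.
  destruct (continuity_ab_maj (fun t => Rabs (f t)) a b Hab) as [m [Hm _]].
  - intros t Ht. apply continuity_pt_filterlim.
    apply (continuous_comp f Rabs); [now apply Hf|apply continuous_Rabs].
  - now exists (Rabs (f m)).
Qed.

Lemma ex_RInt_continuous_le (f : R -> R) (a b : R) : a <= b ->
  (forall t, a <= t <= b -> continuous f t) -> ex_RInt f a b.
Proof.
  intros Hab Hf. apply @ex_RInt_continuous. now rewrite Rmin_left, Rmax_right by trivial.
Qed.

Lemma is_RInt_continuous (f : R -> R) (a b : R) :
  (forall t, continuous f t) -> is_RInt f a b (RInt f a b).
Proof.
  intros Hf. apply (@RInt_correct R_CompleteNormedModule), @ex_RInt_continuous. intros; apply Hf.
Qed.

Lemma is_RInt_eq (f : R -> R) (a b l l' : R) : is_RInt f a b l -> is_RInt f a b l' -> l = l'.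
Proof.
  intros H H'. apply (@is_RInt_unique R_CompleteNormedModule) in H, H'. congruence.
Qed.

Lemma is_RInt_linear_comb (f g : R -> R) (a b u v lf lg : R) :
  is_RInt f a b lf -> is_RInt g a b lg ->
  is_RInt (fun t => u * f t + v * g t) a b (u * lf + v * lg).
Proof. intros. apply @is_RInt_plus; now apply @is_RInt_scal. Qed.

Lemma is_RInt_primitive (f F : R -> R) (a b : R) :
  (forall t, is_derive F t (f t)) -> (forall t, continuous f t) ->
  is_RInt f a b (F b - F a).
Proof. intros HF Hf. apply (is_RInt_derive F f); intros; [apply HF|apply Hf]. Qed.

Lemma is_derive_RInt_continuous (f : R -> R) (a x : R) :
  (forall t, continuous f t) -> is_derive (fun x => RInt f a x) x (f x).
Proof.
  intros Hf. apply (is_derive_RInt f (fun x => RInt f a x) a x); [|apply Hf].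
  exists (mkposreal 1 Rlt_0_1). intros y _. now apply is_RInt_continuous.
Qed.

Lemma is_derive_RInt_param_continuous (f f1 : R -> R -> R) (a b x : R) :
  locally x (fun z => forall t, is_derive (fun z => f z t) z (f1 z t)) ->
  locally x (fun z => forall t, continuous (f z) t) ->
  (forall t, continuous (fun p : R * R => f1 (fst p) (snd p)) (x, t)) ->
  is_derive (fun z => RInt (f z) a b) x (RInt (f1 x) a b).
Proof.
  intros Df Cf Cf1. evar_last.
  - apply (is_derive_RInt_param f a b x).
    + apply filter_imp with (2 := Df). intros z Hz t _. eexists. apply Hz.
    + intros t _. apply (continuity_2d_pt_ext_loc f1).
      * destruct Df as [d Hd]. exists d. intros u v Hu _. symmetry.
        apply is_derive_unique. now apply Hd.
      * apply continuity_2d_pt_filterlim, Cf1.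
    + apply filter_imp with (2 := Cf). intros z Hz.
      apply @ex_RInt_continuous. intros; apply Hz.
  - apply RInt_ext. intros t _. apply is_derive_unique. apply (locally_singleton _ _ Df).
Qed.

Lemma is_lim_seq_inv_INR_S : is_lim_seq (fun N => / (INR N + 1)) 0.
Proof.
  apply (is_lim_seq_inv _ p_infty); [|easy].
  eapply is_lim_seq_plus; [apply is_lim_seq_INR|apply is_lim_seq_const|reflexivity].
Qed.

Lemma is_lim_seq_shift_ratio (p q : R) : 0 < q ->
  is_lim_seq (fun k => (p + INR k) / (q + INR k)) 1.
Proof.
  intros Hq.
  apply (is_lim_seq_ext (fun k => 1 + (p - q) * / (q + INR k))).
  { intros k. field. pose proof (pos_INR k); lra. }
  replace (Finite 1) with (Finite (1 + (p - q) * 0)) by (f_equal; ring).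
  apply is_lim_seq_plus'; [apply is_lim_seq_const|].
  apply (is_lim_seq_scal_l _ (p - q) 0), (is_lim_seq_inv _ p_infty); [|easy].
  eapply is_lim_seq_plus; [apply is_lim_seq_const|apply is_lim_seq_INR|reflexivity].
Qed.

Lemma Series_finite (u : nat -> R) (N : nat) : (forall k, (N < k)%nat -> u k = 0) ->
  Series u = sum_f_R0 u N.
Proof.
  intros Hu. apply is_series_unique. change (is_lim_seq (sum_n u) (sum_f_R0 u N)).
  apply (is_lim_seq_ext_loc (fun _ => sum_f_R0 u N)); [|apply is_lim_seq_const].
  exists N. intros k Hk. rewrite sum_n_Reals. induction Hk as [|k Hk IH]; trivial.
  simpl. rewrite <- IH, Hu by lia. ring.
Qed.

Lemma Series_tail_le (u v : nat -> R) (N : nat) :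
  (forall k, Rabs (u k) <= v k) -> ex_series v ->
  Rabs (Series u - sum_n u N) <= Series v - sum_n v N.
Proof.
  intros Huv Hv.
  assert (Hu : ex_series (fun k => Rabs (u k))).
  { apply (@ex_series_le R_AbsRing R_CompleteNormedModule _ v); trivial.
    intros k. change norm with Rabs. now rewrite Rabs_Rabsolu. }
  rewrite (Series_incr_n u (S N)) by (try lia; now apply ex_series_Rabs).
  rewrite (Series_incr_n v (S N)) by (trivial; lia).
  cbn [pred]. rewrite !sum_n_Reals, !Rplus_minus_l.
  eapply Rle_trans; [apply Series_Rabs|apply Series_le].
  - now apply (ex_series_incr_n (fun k => Rabs (u k)) (S N)).
  - intros k. split; [apply Rabs_pos|apply Huv].
  - now apply (ex_series_incr_n v (S N)).
Qed.

Lemma is_RInt_sum_n (f : nat -> R -> R) (l : nat -> R) (a b : R) (N : nat) :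
  (forall k, is_RInt (f k) a b (l k)) ->
  is_RInt (fun t => sum_n (fun k => f k t) N) a b (sum_n l N).
Proof.
  intros Hf. induction N as [|N IH].
  - rewrite sum_O. apply (is_RInt_ext (f 0%nat)); [intros; now rewrite sum_O|apply Hf].
  - rewrite sum_Sn.
    apply (is_RInt_ext (fun t => plus (sum_n (fun k => f k t) N) (f (S N) t)));
      [intros; now rewrite sum_Sn|].
    now apply @is_RInt_plus.
Qed.

Lemma is_series_RInt_normal (f : nat -> R -> R) (v : nat -> R) (a b : R) : a <= b ->
  (forall k t, a <= t <= b -> continuous (f k) t) ->
  (forall k t, a <= t <= b -> Rabs (f k t) <= v k) -> ex_series v ->
  ex_RInt (fun t => Series (fun k => f k t)) a b ->
  is_series (fun k => RInt (f k) a b) (RInt (fun t => Series (fun k => f k t)) a b).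
Proof.
  intros Hab Hf Hfv Hv Hint.
  set (I := RInt _ a b). set (s := sum_n (fun k => RInt (f k) a b)).
  assert (Hdist : forall N, Rabs (s N - I) <= (b - a) * (Series v - sum_n v N)).
  { intros N.
    assert (D : is_RInt (fun t => minus (sum_n (fun k => f k t) N) (Series (fun k => f k t)))
      a b (s N - I)).
    { apply (@is_RInt_minus R_NormedModule); [|now apply (@RInt_correct R_CompleteNormedModule)].
      apply is_RInt_sum_n. intros k.
      apply (@RInt_correct R_CompleteNormedModule), ex_RInt_continuous_le; auto. }
    rewrite <- (is_RInt_unique _ _ _ _ D).
    apply abs_RInt_le_const; [trivial|eexists; exact D|]. intros t Ht.
    change minus with Rminus. rewrite Rabs_minus_sym.
    apply (Series_tail_le (fun k => f k t)); auto. }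
  assert (Htail : is_lim_seq (fun N => (b - a) * (Series v - sum_n v N)) 0).
  { replace (Finite 0) with (Finite ((b - a) * (Series v - Series v))) by (f_equal; ring).
    apply (is_lim_seq_scal_l _ (b - a) (Series v - Series v)).
    apply is_lim_seq_minus'; [apply is_lim_seq_const|exact (Series_correct _ Hv)]. }
  change (is_lim_seq s I). apply (is_lim_seq_ext (fun N => s N - I + I)); [intros; ring|].
  replace (Finite I) with (Finite (0 + I)) by (f_equal; ring).
  apply is_lim_seq_plus'; [|apply is_lim_seq_const]. apply is_lim_seq_abs_0.
  apply (is_lim_seq_le_le (fun _ => 0) _ _ 0) with (3 := Htail); [|apply is_lim_seq_const].
  intros N. split; [apply Rabs_pos|apply Hdist].
Qed.

Lemma is_series_RInt_PSeries (w g : R -> R) (c : nat -> R) (a b r : R) : a <= b ->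
  (forall t, a <= t <= b -> continuous w t) -> (forall t, a <= t <= b -> continuous g t) ->
  (forall t, a <= t <= b -> Rabs (g t) <= r) -> Rbar_lt r (CV_radius c) ->
  is_series (fun k => c k * RInt (fun t => w t * g t ^ k) a b)
    (RInt (fun t => w t * PSeries c (g t)) a b).
Proof.
  intros Hab Hw Hg Hgr Hr.
  destruct (continuous_segment_bounded w a b Hab Hw) as [M HM].
  assert (Hr0 : Rabs r = r).
  { apply Rabs_pos_eq, Rle_trans with (Rabs (g a)); [apply Rabs_pos|apply Hgr; lra]. }
  set (f := fun k t => w t * (c k * g t ^ k)).
  assert (Hcont : forall k t, a <= t <= b -> continuous (f k) t).
  { intros k t Ht. unfold f. continuity_arith; auto. }
  assert (Hsum : forall t, Series (fun k => f k t) = w t * PSeries c (g t))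
    by (intros t; apply Series_scal_l).
  apply (is_series_ext (fun k => RInt (f k) a b)).
  { intros k. apply is_RInt_unique.
    apply (is_RInt_ext (fun t => scal (c k) (w t * g t ^ k))).
    - intros t _. unfold f, scal; simpl; unfold mult; simpl. ring.
    - apply @is_RInt_scal, (@RInt_correct R_CompleteNormedModule), ex_RInt_continuous_le; trivial.
      intros t Ht. continuity_arith; auto. }
  rewrite <- (RInt_ext (fun t => Series (fun k => f k t))) by (intros; apply Hsum).
  apply (is_series_RInt_normal f (fun k => M * Rabs (c k * r ^ k))); trivial.
  - intros k t Ht. unfold f. rewrite !Rabs_mult, <- !RPow_abs, Hr0.
    apply Rmult_le_compat; [apply Rabs_pos| |now apply HM|].
    + apply Rmult_le_pos; [apply Rabs_pos|apply pow_le, Rabs_pos].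
    + apply Rmult_le_compat_l; [apply Rabs_pos|]. apply pow_incr.
      split; [apply Rabs_pos|now apply Hgr].
  - apply @ex_series_scal_l, CV_disk_inside. now rewrite Hr0.
  - apply (ex_RInt_ext (fun t => w t * PSeries c (g t))); [intros; now rewrite Hsum|].
    apply ex_RInt_continuous_le; trivial. intros t Ht.
    apply (continuous_mult w (fun t => PSeries c (g t))); auto.
    apply (continuous_comp g (PSeries c)); auto.
    apply continuity_pt_filterlim, PSeries_continuity.
    eapply Rbar_le_lt_trans; [|exact Hr]. now apply Hgr.
Qed.

(** * Elementary functions *)

Lemma pow_opp_1_sqr (m : nat) : (-1) ^ m * (-1) ^ m = 1.
Proof. rewrite <- Rpow_mult_distr, <- (pow1 m). f_equal. ring. Qed.

Lemma is_derive_pow_n (j : nat) (x : R) : is_derive (fun x => x ^ j) x (INR j * x ^ pred j).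
Proof. auto_derive; trivial. ring. Qed.

Lemma Rpower_pow2_quarter (x : R) : x <> 0 -> Rpower (x ^ 2) (- / 4) = / sqrt (Rabs x).
Proof.
  intros Hx. pose proof (Rabs_pos_lt x Hx).
  rewrite <- pow2_abs, <- Rpower_pow, Rpower_mult, <- Rpower_sqrt, <- Rpower_Ropp by trivial.
  f_equal. simpl. field.
Qed.

Lemma sin_pow2 (t : R) : sin t ^ 2 = 1 - cos t ^ 2.
Proof. pose proof (sin2_cos2 t). unfold Rsqr in *. lra. Qed.

Lemma is_derive_comp_cos (f : R -> R) (t l : R) :
  is_derive f (cos t) l -> is_derive (fun t => f (cos t)) t (- l * sin t).
Proof.
  intros Hf. evar_last; [apply (is_derive_comp_R f cos t l (- sin t) Hf)|simpl; ring].
  apply is_derive_cos.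
Qed.

Lemma continuous_comp_cos (f : R -> R) (t l : R) :
  is_derive f (cos t) l -> continuous (fun t => f (cos t)) t.
Proof. apply continuous_comp_is_derive, continuous_cos. Qed.

Lemma abs_cos_lt_1 (t : R) : 0 < t < PI -> Rabs (cos t) < 1.
Proof.
  intros Ht. pose proof (sin_gt_0 t ltac:(lra) ltac:(lra)). pose proof (sin_pow2 t).
  apply Rabs_def1; nra.
Qed.

Lemma cos_plus_le_abs (t t' : R) : 0 <= t <= PI -> 0 <= t' <= PI -> cos (t + t') <= Rabs (cos t').
Proof.
  intros Ht Ht'. destruct (Rle_dec (t + t') PI) as [Hle|Hgt].
  - apply Rle_trans with (cos t'); [|apply Rle_abs]. apply cos_decr_1; lra.
  - apply Rle_trans with (- cos t'); [|rewrite <- Rabs_Ropp; apply Rle_abs].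
    rewrite <- neg_cos. apply cos_incr_1; lra.
Qed.

Lemma one_minus_cos_ge (x : R) : Rabs x <= PI -> x ^ 2 / 18 <= 1 - cos x.
Proof.
  intros Hx. set (y := Rabs x / 2). pose proof (Rabs_pos x). pose proof PI_4.
  assert (Hy : 0 <= y <= 2) by (unfold y; lra).
  assert (Hcos : cos x = 1 - 2 * sin y * sin y).
  { rewrite <- cos_2a_sin. unfold y. replace (2 * (Rabs x / 2)) with (Rabs x) by field.
    unfold Rabs. destruct (Rcase_abs x); [now rewrite cos_neg|easy]. }
  assert (Hsin : y / 3 <= sin y).
  { destruct (sin_bound y 0 ltac:(unfold y; lra) ltac:(unfold y; lra)) as [Htaylor _].
    unfold sin_approx, sin_term in Htaylor. simpl in Htaylor.
    assert (0 <= y * (4 - y ^ 2)) by (apply Rmult_le_pos; nra). nra. }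
  assert (y / 3 * (y / 3) <= sin y * sin y) by (apply Rmult_le_compat; lra).
  assert (x ^ 2 = 4 * y ^ 2) by (unfold y; rewrite <- (pow2_abs x); field).
  rewrite Hcos. nra.
Qed.

Lemma cotan_decreasing (z L : R) : 0 < z < L -> L < PI -> cos L / sin L < cos z / sin z.
Proof.
  intros Hz HL. assert (0 < sin z) by (apply sin_gt_0; lra).
  assert (0 < sin L) by (apply sin_gt_0; lra).
  apply Rminus_lt_0. replace (cos z / sin z - cos L / sin L) with (sin (L - z) / (sin z * sin L))
    by (rewrite sin_minus; field; lra).
  apply Rdiv_lt_0_compat; [apply sin_gt_0; lra|now apply Rmult_lt_0_compat].
Qed.

Lemma cosh_plus (s s' : R) : cosh (s + s') = cosh s * cosh s' + sinh s * sinh s'.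
Proof. unfold cosh, sinh. rewrite Ropp_plus_distr, !exp_plus. field. Qed.

Lemma cosh_minus (s s' : R) : cosh (s - s') = cosh s * cosh s' - sinh s * sinh s'.
Proof.
  unfold cosh, sinh, Rminus. rewrite Ropp_plus_distr, Ropp_involutive, !exp_plus. field.
Qed.

Lemma cosh_pow2 (s : R) : cosh s ^ 2 = 1 + sinh s ^ 2.
Proof.
  unfold cosh, sinh.
  assert (exp s * exp (- s) = 1) by (rewrite <- exp_plus, Rplus_opp_r; apply exp_0).
  nra.
Qed.

Lemma sinh_pos (s : R) : 0 < s -> 0 < sinh s.
Proof. intros Hs. apply sinh_lt in Hs. now rewrite sinh_0 in Hs. Qed.

Lemma cosh_ge_1 (s : R) : 1 <= cosh s.
Proof.
  assert (0 < cosh s) by (unfold cosh; pose proof (exp_pos s); pose proof (exp_pos (- s)); lra).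
  pose proof (cosh_pow2 s). pose proof (pow2_ge_0 (sinh s)). nra.
Qed.

Lemma cosh_gt_1 (s : R) : s <> 0 -> 1 < cosh s.
Proof.
  intros Hs. assert (sinh s <> 0).
  { destruct (Rdichotomy _ _ Hs) as [Hs'|Hs']; apply sinh_lt in Hs'; rewrite sinh_0 in Hs'; lra. }
  pose proof (cosh_pow2 s). pose proof (cosh_ge_1 s).
  assert (0 < sinh s ^ 2) by now apply pow2_gt_0. nra.
Qed.

Lemma sqrt_cosh_pow2 (s : R) : 0 <= s -> sqrt (cosh s ^ 2 - 1) = sinh s.
Proof.
  intros Hs. rewrite cosh_pow2. replace (1 + sinh s ^ 2 - 1) with (sinh s ^ 2) by ring.
  apply sqrt_pow2. destruct (Req_dec s 0) as [->|]; [rewrite sinh_0; lra|].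
  apply Rlt_le, sinh_pos. lra.
Qed.

Lemma cosh_le (s s' : R) : 0 <= s <= s' -> cosh s <= cosh s'.
Proof.
  intros Hs. destruct (Req_dec s s') as [->|Hne]; [lra|].
  pose proof (cosh_pow2 s). pose proof (cosh_pow2 s').
  pose proof (cosh_ge_1 s). pose proof (cosh_ge_1 s').
  assert (0 <= sinh s) by (rewrite <- sqrt_cosh_pow2 by lra; apply sqrt_pos).
  assert (sinh s < sinh s') by (apply sinh_lt; lra). nra.
Qed.

Lemma continuous_sinh (x : R) : continuous sinh x.
Proof. apply @ex_derive_continuous. eexists. apply is_derive_Reals, derivable_pt_lim_sinh. Qed.

Lemma continuous_cosh (x : R) : continuous cosh x.
Proof. apply @ex_derive_continuous. eexists. apply is_derive_Reals, derivable_pt_lim_cosh. Qed.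

(** * Power series of hypergeometric type *)

Definition PSeries_deriv (c : nat -> R) (j : nat) (x : R) : R :=
  PSeries (Nat.iter j PS_derive c) x.

Lemma CV_radius_iter_derive (c : nat -> R) (j : nat) :
  CV_radius (Nat.iter j PS_derive c) = CV_radius c.
Proof. induction j as [|j IH]; trivial. simpl. now rewrite CV_radius_derive. Qed.

Lemma is_derive_PSeries_deriv (c : nat -> R) (j : nat) (x : R) :
  Rbar_lt (Rabs x) (CV_radius c) ->
  is_derive (PSeries_deriv c j) x (PSeries_deriv c (S j) x).
Proof. intros Hx. apply is_derive_PSeries. now rewrite CV_radius_iter_derive. Qed.

Lemma ex_pseries_inside (c : nat -> R) (x r : R) :
  CV_radius c = r -> Rabs x < r -> ex_pseries c x.
Proof. intros Hc Hx. apply CV_radius_inside. now rewrite Hc. Qed.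

Lemma CV_radius_ratio_1 (c : nat -> R) :
  (forall k, 0 < c k) -> is_lim_seq (fun k => c (S k) / c k) 1 -> CV_radius c = 1.
Proof.
  intros Hc Hl. rewrite (CV_radius_finite_DAlembert c 1); [now rewrite Rinv_1| |lra|].
  - intros k; specialize (Hc k); lra.
  - apply is_lim_seq_ext with (2 := Hl). intros k. rewrite Rabs_pos_eq; trivial.
    now apply Rlt_le, Rdiv_lt_0_compat.
Qed.

Lemma PSeries_le (a b : nat -> R) (x : R) : 0 <= x -> (forall k, 0 <= a k <= b k) ->
  ex_pseries b x -> 0 <= PSeries a x <= PSeries b x.
Proof.
  intros Hx Hab Hb. unfold PSeries.
  assert (Hb' : ex_series (fun k => b k * x ^ k)).
  { apply (ex_series_ext (fun k => scal (pow_n x k) (b k))); [|exact Hb].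
    intros k. rewrite pow_n_pow. apply Rmult_comm. }
  assert (Hterm : forall k, 0 <= a k * x ^ k <= b k * x ^ k).
  { intros k. destruct (Hab k). assert (0 <= x ^ k) by now apply pow_le. nra. }
  split; [|now apply Series_le].
  replace 0 with (Series (fun _ => 0 * 0)) by (rewrite Series_scal_l; ring).
  apply Series_le; [intros k; rewrite Rmult_0_l; split; [lra|apply Hterm]|].
  apply (@ex_series_le R_AbsRing R_CompleteNormedModule _ (fun k => b k * x ^ k)); trivial.
  intros k. change norm with Rabs. rewrite Rabs_pos_eq; apply Hterm.
Qed.

Lemma le_scal_of_ratio_le (N : nat) : forall u v : nat -> R,
  (forall k, 0 < u k) -> (forall k, 0 < v k) ->
  (forall k, (N <= k)%nat -> u (S k) * v k <= u k * v (S k)) ->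
  exists C, 0 < C /\ forall k, u k <= C * v k.
Proof.
  induction N as [|N IH]; intros u v Hu Hv Huv.
  - exists (u O / v O). split; [now apply Rdiv_lt_0_compat|].
    induction k as [|k IHk]; [right; field; specialize (Hv O); lra|].
    apply (Rmult_le_reg_r (v k)); trivial.
    apply Rle_trans with (1 := Huv k ltac:(lia)).
    replace (u O / v O * v (S k) * v k) with (u O / v O * v k * v (S k)) by ring.
    apply Rmult_le_compat_r; [now apply Rlt_le|easy].
  - destruct (IH (fun k => u (S k)) (fun k => v (S k))) as [C [HC Hk]]; auto.
    { intros k Hk. apply Huv. lia. }
    assert (Hratio : 0 < u O / v O) by now apply Rdiv_lt_0_compat.
    exists (C + u O / v O). split; [lra|]. intros [|k].
    + specialize (Hv O). rewrite Rmult_plus_distr_r. field_simplify (u O / v O * v O); nra.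
    + specialize (Hk k). specialize (Hv (S k)). nra.
Qed.

Lemma poch_pos (a : R) (k : nat) : 0 < a -> 0 < poch a k.
Proof.
  intros Ha. induction k as [|k IH]; simpl; [lra|].
  apply Rmult_lt_0_compat; trivial. pose proof (pos_INR k); lra.
Qed.

Lemma poch_INR_S (n k : nat) :
  poch (INR n + 1) k = INR (Factorial.fact (n + k)) / INR (Factorial.fact n).
Proof.
  induction k as [|k IH]; simpl poch.
  - rewrite Nat.add_0_r. field. apply INR_fact_neq_0.
  - rewrite IH, <- plus_n_Sm, fact_simpl, mult_INR, S_INR, plus_INR. field. apply INR_fact_neq_0.
Qed.

Lemma poch_opp_INR (n k : nat) : (k <= n)%nat ->
  poch (- INR n) k = (-1) ^ k * (INR (Factorial.fact n) / INR (Factorial.fact (n - k))).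
Proof.
  induction k as [|k IH]; intros Hk; simpl poch.
  - rewrite Nat.sub_0_r. field. apply INR_fact_neq_0.
  - rewrite IH by lia. replace (n - k)%nat with (S (n - S k)) by lia.
    rewrite fact_simpl, mult_INR, <- Nat.sub_succ_l, Nat.sub_succ, minus_INR by lia. simpl pow.
    assert (INR n - INR k <> 0) by (rewrite <- minus_INR by lia; apply not_0_INR; lia).
    field. split; [apply INR_fact_neq_0|trivial].
Qed.

Lemma poch_opp_INR_eq_0 (n k : nat) : (n < k)%nat -> poch (- INR n) k = 0.
Proof.
  induction k as [|k IH]; intros Hk; [lia|]. simpl.
  destruct (Nat.eq_dec k n) as [->|]; [ring|]. rewrite IH by lia. ring.
Qed.

Lemma gamma_half_pos (j : nat) : 0 < gamma_half j.
Proof.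
  induction j as [|j IH]; simpl; [apply sqrt_lt_R0, PI_RGT_0|].
  pose proof (pos_INR j). apply Rmult_lt_0_compat; lra.
Qed.

Lemma gamma_half_S (j : nat) : gamma_half (S j) = gamma_half j * (INR j + /2).
Proof. reflexivity. Qed.

Lemma gamma_half_fact (j : nat) : gamma_half j =
  INR (Factorial.fact (2 * j)) * sqrt PI / (4 ^ j * INR (Factorial.fact j)).
Proof.
  induction j as [|j IH]; [simpl; field|].
  rewrite gamma_half_S, IH. replace (2 * S j)%nat with (S (S (2 * j))) by lia.
  rewrite !fact_simpl, !mult_INR, !S_INR, mult_INR. simpl (INR 2). simpl pow.
  pose proof (pos_INR j). assert (0 < 4 ^ j) by (apply pow_lt; lra).
  field. repeat split; try apply INR_fact_neq_0; lra.
Qed.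

Definition hyp2F1_coef (a b : R) (rgc : nat -> R) (k : nat) : R :=
  poch a k * poch b k * rgc k / INR (Factorial.fact k).

Section Hypergeometric.
Variables (a b c : R) (rgc : nat -> R).
(* The functional equation of [rgc k = 1 / Gamma (c + k)]. *)
Hypothesis rgc_S : forall k, rgc k = (c + INR k) * rgc (S k).

Lemma hyp2F1_coef_S (k : nat) :
  (INR k + 1) * (c + INR k) * hyp2F1_coef a b rgc (S k) =
  (a + INR k) * (b + INR k) * hyp2F1_coef a b rgc k.
Proof.
  unfold hyp2F1_coef. rewrite (rgc_S k), fact_simpl, mult_INR, S_INR. simpl poch.
  pose proof (pos_INR k). field. split; [apply INR_fact_neq_0|lra].
Qed.

Hypotheses (a_gt_0 : 0 < a) (b_gt_0 : 0 < b) (c_gt_0 : 0 < c) (rgc_gt_0 : forall k, 0 < rgc k).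

Lemma hyp2F1_coef_pos (k : nat) : 0 < hyp2F1_coef a b rgc k.
Proof.
  apply Rdiv_lt_0_compat; [|apply INR_fact_lt_0].
  apply Rmult_lt_0_compat; [apply Rmult_lt_0_compat; now apply poch_pos|apply rgc_gt_0].
Qed.

Lemma CV_radius_hyp2F1 : CV_radius (hyp2F1_coef a b rgc) = 1.
Proof.
  apply CV_radius_ratio_1; [apply hyp2F1_coef_pos|].
  replace (Finite 1) with (Finite (1 * 1)) by (f_equal; ring).
  apply is_lim_seq_ext with (2 := is_lim_seq_mult' _ _ _ _
    (is_lim_seq_shift_ratio a 1 Rlt_0_1) (is_lim_seq_shift_ratio b c c_gt_0)).
  intros k. pose proof (hyp2F1_coef_pos k). pose proof (pos_INR k).
  assert (D : 0 < (INR k + 1) * (c + INR k)) by nra.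
  apply (Rmult_eq_reg_r ((INR k + 1) * (c + INR k) * hyp2F1_coef a b rgc k)); [|nra].
  transitivity ((INR k + 1) * (c + INR k) * hyp2F1_coef a b rgc (S k)).
  - rewrite hyp2F1_coef_S. field. lra.
  - field. lra.
Qed.

Lemma hyp2F1_ode (x : R) : Rabs x < 1 ->
  let F := PSeries_deriv (hyp2F1_coef a b rgc) in
  x * (1 - x) * F 2%nat x + (c - (a + b + 1) * x) * F 1%nat x - a * b * F 0%nat x = 0.
Proof.
  intros Hx. cbv zeta. unfold PSeries_deriv; simpl.
  set (g := hyp2F1_coef a b rgc).
  assert (R0 : CV_radius g = 1) by apply CV_radius_hyp2F1.
  assert (R1 : CV_radius (PS_derive g) = 1) by now rewrite CV_radius_derive.
  assert (R2 : CV_radius (PS_derive (PS_derive g)) = 1) by now rewrite CV_radius_derive.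
  assert (Hlow : x * PSeries (PS_derive (PS_derive g)) x + c * PSeries (PS_derive g) x =
    PSeries (fun k => (a + INR k) * (b + INR k) * g k) x).
  { rewrite <- PSeries_incr_1, <- PSeries_scal, <- PSeries_plus.
    - apply PSeries_ext. intros k. unfold g. rewrite <- hyp2F1_coef_S. fold g.
      unfold PS_plus, PS_scal, PS_incr_1. change plus with Rplus; change scal with Rmult.
      destruct k as [|k]; unfold PS_derive; [change zero with 0; simpl|rewrite !S_INR]; ring.
    - now apply ex_pseries_incr_1, (ex_pseries_inside _ _ 1).
    - apply ex_pseries_scal; [apply Rmult_comm|]. now apply (ex_pseries_inside _ _ 1). }
  assert (Hhigh : x * (x * PSeries (PS_derive (PS_derive g)) x)
      + (a + b + 1) * (x * PSeries (PS_derive g) x) + a * b * PSeries g x =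
    PSeries (fun k => (a + INR k) * (b + INR k) * g k) x).
  { rewrite <- !PSeries_incr_1, <- !PSeries_scal, <- !PSeries_plus.
    - apply PSeries_ext. intros k.
      unfold PS_plus, PS_scal, PS_incr_1. change plus with Rplus; change scal with Rmult.
      change (@zero R_NormedModule) with 0. change (@zero R_AbelianGroup) with 0.
      destruct k as [|[|k]]; unfold PS_derive; rewrite ?S_INR; simpl INR; ring.
    - apply ex_pseries_plus.
      + now apply ex_pseries_incr_1, ex_pseries_incr_1, (ex_pseries_inside _ _ 1).
      + apply ex_pseries_scal; [apply Rmult_comm|].
        now apply ex_pseries_incr_1, (ex_pseries_inside _ _ 1).
    - apply ex_pseries_scal; [apply Rmult_comm|]. now apply (ex_pseries_inside _ _ 1).
    - now apply ex_pseries_incr_1, ex_pseries_incr_1, (ex_pseries_inside _ _ 1).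
    - apply ex_pseries_scal; [apply Rmult_comm|].
      now apply ex_pseries_incr_1, (ex_pseries_inside _ _ 1). }
  rewrite <- Hlow in Hhigh. lra.
Qed.
End Hypergeometric.

(* The coefficients [(al)_k / k!] of [(1 - x) ^ (- al)], as those of [F (al, 1; 1; x)]. *)
Definition binom_coef (al : R) : nat -> R :=
  hyp2F1_coef al 1 (fun k => / INR (Factorial.fact k)).

Lemma inv_fact_S (m k : nat) : / INR (Factorial.fact (m + k)) =
  (INR m + 1 + INR k) * / INR (Factorial.fact (m + S k)).
Proof.
  rewrite <- plus_n_Sm, fact_simpl, mult_INR, S_INR, plus_INR.
  pose proof (pos_INR m). pose proof (pos_INR k). field. split; [apply INR_fact_neq_0|lra].
Qed.

Lemma inv_fact_pos (n : nat) : 0 < / INR (Factorial.fact n).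
Proof. apply Rinv_0_lt_compat, INR_fact_lt_0. Qed.

Lemma binom_coef_pos (al : R) (k : nat) : 0 < al -> 0 < binom_coef al k.
Proof. intros Ha. apply hyp2F1_coef_pos; trivial; [lra|apply inv_fact_pos]. Qed.

Lemma binom_coef_S (al : R) (k : nat) :
  (INR k + 1) * binom_coef al (S k) = (al + INR k) * binom_coef al k.
Proof.
  pose proof (pos_INR k). apply (Rmult_eq_reg_l (1 + INR k)); [|lra].
  pose proof (hyp2F1_coef_S al 1 1 (fun k => / INR (Factorial.fact k))) as E.
  unfold binom_coef. rewrite <- !Rmult_assoc, (Rmult_comm (1 + INR k) (INR k + 1)), E; [ring|].
  intros j. apply (eq_trans (inv_fact_S 0 j)). f_equal. simpl. ring.
Qed.

Lemma CV_radius_binom (al : R) : 0 < al -> CV_radius (binom_coef al) = 1.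
Proof.
  intros Ha. apply (CV_radius_hyp2F1 al 1 1); try lra; [|apply inv_fact_pos].
  intros k. apply (eq_trans (inv_fact_S 0 k)). f_equal. simpl. ring.
Qed.

Lemma binom_coef_INR_S (n k : nat) : binom_coef (INR n + 1) k =
  INR (Factorial.fact (n + k)) / (INR (Factorial.fact n) * INR (Factorial.fact k)).
Proof.
  unfold binom_coef, hyp2F1_coef. replace 1 with (INR 0 + 1) at 2 by (simpl; ring).
  rewrite !poch_INR_S. simpl. field. split; apply INR_fact_neq_0.
Qed.

Lemma PSeries_binom_derive (al x : R) : 0 < al -> Rabs x < 1 ->
  (1 - x) * PSeries (PS_derive (binom_coef al)) x = al * PSeries (binom_coef al) x.
Proof.
  intros Ha Hx. pose proof (CV_radius_binom al Ha) as Hr.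
  rewrite Rmult_minus_distr_r, Rmult_1_l, <- PSeries_incr_1, <- PSeries_scal.
  apply Rminus_diag_uniq. rewrite Rminus_def, Rminus_def, Rplus_assoc, <- Ropp_plus_distr.
  apply Rminus_diag_eq. rewrite <- PSeries_plus.
  - apply PSeries_ext. intros k. unfold PS_plus, PS_scal, PS_incr_1, PS_derive.
    rewrite S_INR, binom_coef_S. change plus with Rplus; change scal with Rmult.
    destruct k as [|k]; [change zero with 0; simpl; ring|]. rewrite !S_INR. ring.
  - now apply ex_pseries_incr_1, (ex_pseries_inside _ _ 1); [rewrite CV_radius_derive|].
  - apply ex_pseries_scal; [apply Rmult_comm|]. now apply (ex_pseries_inside _ _ 1).
Qed.

Lemma PSeries_binom (al x : R) : 0 < al -> Rabs x < 1 ->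
  PSeries (binom_coef al) x = Rpower (1 - x) (- al).
Proof.
  intros Ha Hx. apply Rabs_def2 in Hx as Hx'.
  apply (Rmult_eq_reg_r (Rpower (1 - x) al)); [|apply Rgt_not_eq, exp_pos].
  rewrite <- Rpower_plus, Rplus_opp_l, Rpower_O by lra.
  set (h := fun x => PSeries (binom_coef al) x * Rpower (1 - x) al).
  assert (Hh : forall z, Rabs z < 1 -> is_derive h z 0).
  { intros z Hz. apply Rabs_def2 in Hz as Hz'.
    assert (D := is_derive_PSeries (binom_coef al) z).
    rewrite CV_radius_binom in D by trivial. specialize (D Hz).
    unfold h, Rpower. auto_derive_hyps; [lra|].
    replace (1 + - z) with (1 - z) by ring. apply (Rmult_eq_reg_l (1 - z)); [|lra].
    rewrite Rmult_0_r.
    transitivity (((1 - z) * PSeries (PS_derive (binom_coef al)) z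
      - al * PSeries (binom_coef al) z) * exp (al * ln (1 - z))); [field; lra|].
    rewrite PSeries_binom_derive by trivial. ring. }
  assert (h0 : h 0 = 1).
  { unfold h. rewrite PSeries_0, Rminus_0_r. unfold Rpower. rewrite ln_1, Rmult_0_r, exp_0.
    unfold binom_coef, hyp2F1_coef. simpl. field. }
  fold (h x). rewrite <- h0.
  destruct (Rtotal_order x 0) as [Hneg|[->|Hpos]]; trivial; [|symmetry].
  all: apply (eq_is_derive h); trivial; intros t Ht; apply Hh, Rabs_def1; lra.
Qed.

Lemma PSeries_binom_pow (n : nat) (x : R) : Rabs x < 1 ->
  PSeries (binom_coef (INR n + 1)) x = / (1 - x) ^ (n + 1).
Proof.
  intros Hx. pose proof (pos_INR n). rewrite PSeries_binom by (trivial; lra).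
  apply Rabs_def2 in Hx.
  now rewrite Rpower_Ropp, <- Rpower_pow, plus_INR by lra.
Qed.

(* For [al > a + b - c] the ratios of the coefficients are eventually smaller than those of
   [(1 - x) ^ (- al)]. *)
Lemma hyp2F1_singularity (a b c : R) (rgc : nat -> R) (al : R) :
  0 < a -> 0 < b -> 0 < c -> (forall k, rgc k = (c + INR k) * rgc (S k)) ->
  (forall k, 0 < rgc k) -> 0 < al -> a + b - c < al ->
  exists C, 0 < C /\ forall x, 0 <= x < 1 ->
    0 <= PSeries (hyp2F1_coef a b rgc) x <= C * Rpower (1 - x) (- al).
Proof.
  intros Ha Hb Hc Hrgc Hrgc0 Hal Habc.
  destruct (INR_unbounded (Rabs (a * b - al * c) / (al + c - a - b))) as [N HN].
  destruct (le_scal_of_ratio_le N (hyp2F1_coef a b rgc) (binom_coef al)) as [C [HC Hle]].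
  - intros k. now apply hyp2F1_coef_pos.
  - intros k. now apply binom_coef_pos.
  - intros k Hk. apply le_INR in Hk. pose proof (pos_INR k).
    assert (HabN : a * b - al * c <= (al + c - a - b) * INR k).
    { apply Rle_trans with (1 := Rle_abs _). rewrite (Rmult_comm _ (INR k)).
      apply -> Rle_div_l; lra. }
    apply (Rmult_le_reg_l ((INR k + 1) * (c + INR k))); [nra|].
    rewrite <- Rmult_assoc, (hyp2F1_coef_S a b c rgc Hrgc).
    replace ((INR k + 1) * (c + INR k) * (hyp2F1_coef a b rgc k * binom_coef al (S k)))
      with ((c + INR k) * hyp2F1_coef a b rgc k * ((INR k + 1) * binom_coef al (S k))) by ring.
    rewrite binom_coef_S.
    pose proof (hyp2F1_coef_pos a b rgc Ha Hb Hrgc0 k). pose proof (binom_coef_pos al k Hal).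
    assert (0 < hyp2F1_coef a b rgc k * binom_coef al k) by now apply Rmult_lt_0_compat.
    nra.
  - exists C. split; trivial. intros x Hx.
    assert (Rabs x < 1) by (rewrite Rabs_pos_eq; lra).
    rewrite <- PSeries_binom, <- PSeries_scal by trivial. apply PSeries_le; [lra| |].
    + intros k. split; [now apply Rlt_le, (hyp2F1_coef_pos a b rgc)|apply Hle].
    + apply ex_pseries_scal; [apply Rmult_comm|].
      apply (ex_pseries_inside _ _ 1); trivial. now apply CV_radius_binom.
Qed.

(** * Derivatives of the Legendre polynomials *)

(* [P_n^(m) (x)], by the Bonnet recurrence differentiated [m] times. *)
Fixpoint legendre_deriv (n m : nat) (x : R) : R :=
  match n with
  | O => match m with O => 1 | _ => 0 end
  | S O => match m with O => x | S O => 1 | _ => 0 end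
  | S (S n2 as n1) =>
      ((2 * INR n2 + 3) * (x * legendre_deriv n1 m x + INR m * legendre_deriv n1 (pred m) x)
        - (INR n2 + 1) * legendre_deriv n2 m x) / (INR n2 + 2)
  end.

Lemma legendre_deriv_SS (n m : nat) (x : R) :
  legendre_deriv (S (S n)) m x =
  ((2 * INR n + 3) * (x * legendre_deriv (S n) m x + INR m * legendre_deriv (S n) (pred m) x)
    - (INR n + 1) * legendre_deriv n m x) / (INR n + 2).
Proof. reflexivity. Qed.

Arguments legendre_deriv : simpl never.

Lemma is_derive_legendre_deriv (n : nat) : forall (m : nat) (x : R),
  is_derive (legendre_deriv n m) x (legendre_deriv n (S m) x).
Proof.
  induction n as [[|[|n]] IH] using lt_wf_ind; intros m x.
  - destruct m as [|m]; unfold legendre_deriv; auto_derive; trivial.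
  - destruct m as [|[|m]]; unfold legendre_deriv; auto_derive; trivial.
  - assert (INR n + 2 <> 0) by (pose proof (pos_INR n); lra).
    pose proof (IH (S n) ltac:(lia) m x) as D1.
    pose proof (IH (S n) ltac:(lia) (pred m) x) as D1'.
    pose proof (IH n ltac:(lia) m x) as D0.
    apply (is_derive_ext (fun x => ((2 * INR n + 3) *
        (x * legendre_deriv (S n) m x + INR m * legendre_deriv (S n) (pred m) x)
        - (INR n + 1) * legendre_deriv n m x) / (INR n + 2)));
      [intros; now rewrite legendre_deriv_SS|].
    auto_derive_hyps. rewrite legendre_deriv_SS, S_INR.
    destruct m as [|m]; cbn [pred]; [change (INR 0) with 0|]; field; trivial.
Qed.

Lemma legendre_SS (n : nat) (x : R) : legendre (S (S n)) x =
  ((2 * INR n + 3) * x * legendre (S n) x - (INR n + 1) * legendre n x) / (INR n + 2).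
Proof.
  unfold legendre. cbn [legendre_pair]. now destruct (legendre_pair n x) as [p q].
Qed.

Lemma legendre_deriv_0 (n : nat) (x : R) : legendre_deriv n 0 x = legendre n x.
Proof.
  induction n as [[|[|n]] IH] using lt_wf_ind; [reflexivity..|].
  rewrite legendre_deriv_SS, legendre_SS, !IH by lia.
  change (INR 0) with 0. field. pose proof (pos_INR n); lra.
Qed.

Lemma Derive_n_legendre_deriv (n m k : nat) : forall x,
  Derive_n (legendre_deriv n m) k x = legendre_deriv n (m + k) x.
Proof.
  induction k as [|k IH]; intros x; simpl.
  - now rewrite Nat.add_0_r.
  - rewrite (Derive_ext _ _ _ IH), <- plus_n_Sm. apply is_derive_unique, is_derive_legendre_deriv.
Qed.

Lemma Derive_n_legendre (n m : nat) (x : R) :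
  Derive_n (legendre n) m x = legendre_deriv n m x.
Proof.
  transitivity (Derive_n (legendre_deriv n 0) m x); [|apply Derive_n_legendre_deriv].
  apply Derive_n_ext. intros; now rewrite legendre_deriv_0.
Qed.

Lemma legendre_deriv_eq_0 (n : nat) : forall (m : nat) (x : R),
  (n < m)%nat -> legendre_deriv n m x = 0.
Proof.
  induction n as [[|[|n]] IH] using lt_wf_ind; intros m x Hm.
  - destruct m; [lia|reflexivity].
  - destruct m as [|[|m]]; [lia|lia|reflexivity].
  - rewrite legendre_deriv_SS, !IH by lia. field. pose proof (pos_INR n); lra.
Qed.

Lemma continuous_legendre_deriv {T : UniformSpace} (n m : nat) (f : T -> R) (z : T) :
  continuous f z -> continuous (fun z => legendre_deriv n m (f z)) z.
Proof. intros. eapply continuous_comp_is_derive; [easy|apply is_derive_legendre_deriv]. Qed.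

Lemma legendre_deriv_contiguous (n : nat) (x : R) :
  legendre_deriv (S n) 1 x = x * legendre_deriv n 1 x + (INR n + 1) * legendre_deriv n 0 x /\
  x * legendre_deriv (S n) 1 x = legendre_deriv n 1 x + (INR n + 1) * legendre_deriv (S n) 0 x.
Proof.
  induction n as [|n [Hn HSn]]; [unfold legendre_deriv; simpl; lra|].
  assert (n_plus_2_neq_0 : INR n + 2 <> 0) by (pose proof (pos_INR n); lra).
  pose proof (legendre_deriv_SS n 0 x) as B0. pose proof (legendre_deriv_SS n 1 x) as B1.
  cbn [pred] in B0, B1. change (INR 0) with 0 in B0. change (INR 1) with 1 in B1.
  rewrite S_INR.
  assert (HSSn : legendre_deriv (S (S n)) 1 x =
    x * legendre_deriv (S n) 1 x + (INR n + 1 + 1) * legendre_deriv (S n) 0 x).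
  { rewrite B1.
    replace (legendre_deriv n 1 x) with
      (x * legendre_deriv (S n) 1 x - (INR n + 1) * legendre_deriv (S n) 0 x) by lra.
    field; trivial. }
  split; [exact HSSn|].
  assert (Hsq : x * (x * legendre_deriv (S n) 1 x) - legendre_deriv (S n) 1 x =
     (INR n + 1) * (x * legendre_deriv (S n) 0 x) - (INR n + 1) * legendre_deriv n 0 x).
  { rewrite HSn at 1. rewrite Hn at 1. ring. }
  transitivity (legendre_deriv (S n) 1 x
    + (x * (x * legendre_deriv (S n) 1 x) - legendre_deriv (S n) 1 x)
    + (INR n + 2) * (x * legendre_deriv (S n) 0 x)); [rewrite HSSn; ring|].
  rewrite Hsq, B0. field; trivial.
Qed.

Definition gegenbauer_op (m : nat) (x f1 f2 : R) : R :=
  (1 - x ^ 2) * f2 - 2 * (INR m + 1) * x * f1.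

Definition legendre_eigenvalue (m n : nat) : R := INR n * (INR n + 1) - INR m * (INR m + 1).

Lemma legendre_eigenvalue_add (m d : nat) :
  legendre_eigenvalue m (m + d) = INR d * (INR d + 2 * INR m + 1).
Proof. unfold legendre_eigenvalue. rewrite plus_INR. ring. Qed.

Lemma legendre_ode (n : nat) (x : R) :
  gegenbauer_op 0 x (legendre_deriv n 1 x) (legendre_deriv n 2 x)
  + legendre_eigenvalue 0 n * legendre_deriv n 0 x = 0.
Proof.
  unfold gegenbauer_op, legendre_eigenvalue. change (INR 0) with 0.
  destruct n as [|n]; [unfold legendre_deriv; simpl; ring|].
  assert (first_order : forall x, (1 - x ^ 2) * legendre_deriv (S n) 1 x =
     (INR n + 1) * (legendre_deriv n 0 x - x * legendre_deriv (S n) 0 x)).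
  { intros z. destruct (legendre_deriv_contiguous n z) as [Hn HSn].
    replace ((1 - z ^ 2) * legendre_deriv (S n) 1 z)
      with (legendre_deriv (S n) 1 z - z * (z * legendre_deriv (S n) 1 z)) by ring.
    rewrite HSn, Hn. ring. }
  pose proof (is_derive_legendre_deriv n 0 x) as D0.
  pose proof (is_derive_legendre_deriv (S n) 0 x) as DS0.
  pose proof (is_derive_legendre_deriv (S n) 1 x) as DS1.
  assert (Dl : is_derive (fun x => (1 - x ^ 2) * legendre_deriv (S n) 1 x) x
     ((1 - x ^ 2) * legendre_deriv (S n) 2 x - 2 * x * legendre_deriv (S n) 1 x))
    by (auto_derive_hyps; ring).
  assert (Dr : is_derive (fun x => (1 - x ^ 2) * legendre_deriv (S n) 1 x) x
     ((INR n + 1) * (legendre_deriv n 1 x - legendre_deriv (S n) 0 x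
        - x * legendre_deriv (S n) 1 x))).
  { apply (is_derive_ext
      (fun x => (INR n + 1) * (legendre_deriv n 0 x - x * legendre_deriv (S n) 0 x)));
      [intros; now rewrite first_order|].
    auto_derive_hyps. ring. }
  apply is_derive_unique in Dl, Dr. rewrite Dl in Dr.
  destruct (legendre_deriv_contiguous n x) as [_ HSn]. rewrite HSn in Dr. rewrite S_INR. lra.
Qed.

Lemma legendre_deriv_ode (n m : nat) : forall x : R,
  gegenbauer_op m x (legendre_deriv n (S m) x) (legendre_deriv n (S (S m)) x)
  + legendre_eigenvalue m n * legendre_deriv n m x = 0.
Proof.
  induction m as [|m IH]; intros x; [apply legendre_ode|].
  assert (D0 : is_derive (fun x =>
      gegenbauer_op m x (legendre_deriv n (S m) x) (legendre_deriv n (S (S m)) x)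
      + legendre_eigenvalue m n * legendre_deriv n m x) x 0).
  { apply (is_derive_ext (fun _ => 0)); [intros; now rewrite IH|auto_derive; trivial]. }
  apply is_derive_unique in D0. rewrite <- D0. symmetry. apply is_derive_unique.
  pose proof (is_derive_legendre_deriv n m x). pose proof (is_derive_legendre_deriv n (S m) x).
  pose proof (is_derive_legendre_deriv n (S (S m)) x).
  unfold gegenbauer_op, legendre_eigenvalue. auto_derive_hyps. rewrite S_INR. ring.
Qed.

Lemma legendre_at_1 (n : nat) : legendre_deriv n 0 1 = 1.
Proof.
  induction n as [[|[|n]] IH] using lt_wf_ind; [reflexivity..|].
  rewrite legendre_deriv_SS, !IH by lia. change (INR 0) with 0.
  field. pose proof (pos_INR n); lra.
Qed.

Lemma legendre_deriv_at_1_poch (n k : nat) : legendre_deriv n k 1 =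
  poch (INR n + 1) k * poch (- INR n) k / INR (Factorial.fact k) * (- / 2) ^ k.
Proof.
  induction k as [|k IH].
  - rewrite legendre_at_1. simpl. field.
  - pose proof (legendre_deriv_ode n k 1) as ode.
    unfold gegenbauer_op, legendre_eigenvalue in ode. rewrite IH in ode.
    pose proof (INR_fact_neq_0 k). pose proof (pos_INR k).
    apply (Rmult_eq_reg_l (2 * (INR k + 1))); [|lra].
    rewrite fact_simpl, mult_INR, S_INR. simpl poch. simpl pow.
    transitivity ((INR n * (INR n + 1) - INR k * (INR k + 1)) *
      (poch (INR n + 1) k * poch (- INR n) k / INR (Factorial.fact k) * (- / 2) ^ k)); [lra|].
    field. split; trivial. lra.
Qed.

Lemma legendre_deriv_at_1 (n m : nat) : (m <= n)%nat -> legendre_deriv n m 1 =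
  INR (Factorial.fact (n + m)) / (2 ^ m * INR (Factorial.fact m) * INR (Factorial.fact (n - m))).
Proof.
  intros Hm. rewrite legendre_deriv_at_1_poch, poch_INR_S, poch_opp_INR by trivial.
  replace (- / 2) with (-1 * / 2) by lra. rewrite Rpow_mult_distr, pow_inv.
  pose proof (pow_opp_1_sqr m) as Hsign.
  pose proof (pow_nonzero 2 m ltac:(lra)).
  transitivity ((-1) ^ m * (-1) ^ m * (INR (Factorial.fact (n + m)) /
    (2 ^ m * INR (Factorial.fact m) * INR (Factorial.fact (n - m)))));
    [field; repeat split; trivial; apply INR_fact_neq_0|rewrite Hsign; ring].
Qed.

Lemma legendre_deriv_taylor (n m : nat) (z : R) : 1 < z -> legendre_deriv n m z =
  sum_f_R0 (fun k => (z - 1) ^ k / INR (Factorial.fact k) * legendre_deriv n (m + k) 1) n.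
Proof.
  intros Hz. destruct (Taylor_Lagrange (legendre_deriv n m) n 1 z Hz) as [c [_ E]].
  { intros t _ [|k] _; simpl; trivial.
    apply (ex_derive_ext (legendre_deriv n (m + k)));
      [intros; now rewrite Derive_n_legendre_deriv|].
    eexists; apply is_derive_legendre_deriv. }
  rewrite E, Derive_n_legendre_deriv, (legendre_deriv_eq_0 n (m + S n)), Rmult_0_r, Rplus_0_r
    by lia.
  apply sum_eq. intros k _. now rewrite Derive_n_legendre_deriv.
Qed.

(** * The kernel as a symmetric function of four variables *)

Definition neg_half_pow (k : nat) (s : R) : R := / (s ^ k * sqrt s).

Lemma neg_half_pow_pos (k : nat) (s : R) : 0 < s -> 0 < neg_half_pow k s.
Proof.
  intros Hs. apply Rinv_0_lt_compat, Rmult_lt_0_compat; [now apply pow_lt|now apply sqrt_lt_R0].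
Qed.

Lemma neg_half_pow_antitone (k : nat) (s s' : R) :
  0 < s' <= s -> neg_half_pow k s <= neg_half_pow k s'.
Proof.
  intros Hs. apply Rinv_le_contravar.
  - apply Rmult_lt_0_compat; [now apply pow_lt|now apply sqrt_lt_R0].
  - apply Rmult_le_compat; [apply pow_le; lra|apply sqrt_pos|apply pow_incr; lra|].
    apply sqrt_le_1_alt; lra.
Qed.

Lemma neg_half_pow_S (k : nat) (s : R) : s <> 0 -> s * neg_half_pow (S k) s = neg_half_pow k s.
Proof.
  intros Hs. unfold neg_half_pow. simpl pow. rewrite !Rinv_mult, <- !Rmult_assoc.
  now rewrite Rinv_r, Rmult_1_l.
Qed.

Lemma is_derive_neg_half_pow (k : nat) (s : R) : 0 < s ->
  is_derive (neg_half_pow k) s (- (INR k + /2) * neg_half_pow (S k) s).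
Proof.
  intros Hs. pose proof (sqrt_lt_R0 s Hs). pose proof (pow_lt s k Hs).
  assert (E : sqrt s * sqrt s = s) by (apply sqrt_sqrt; lra).
  unfold neg_half_pow. auto_derive; [repeat split; trivial; nra|].
  destruct k as [|k].
  - simpl. set (r := sqrt s) in *. rewrite <- E. field. nra.
  - rewrite S_INR. simpl pred. simpl pow in *. pose proof (pow_lt s k Hs).
    set (r := sqrt s) in *. set (p := s ^ k) in *. clearbody p. rewrite <- E. field. nra.
Qed.

Definition Qhalf_coef (m : nat) : nat -> R :=
  hyp2F1_coef ((INR m - /2) / 2 + 1) ((INR m + /2) / 2) (fun k => / INR (Factorial.fact (m + k))).

Lemma CV_radius_Qhalf (m : nat) : CV_radius (Qhalf_coef m) = 1.
Proof.
  pose proof (pos_INR m). apply (CV_radius_hyp2F1 _ _ (INR m + 1)); try lra.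
  - apply inv_fact_S.
  - intros; apply inv_fact_pos.
Qed.

Lemma Qhalf_ode (m : nat) (u : R) : Rabs u < 1 ->
  let G := PSeries_deriv (Qhalf_coef m) in
  u * (1 - u) * G 2%nat u + (INR m + 1 - (INR m + 2) * u) * G 1%nat u
  - (INR m + /2) * (INR m + 3 / 2) / 4 * G 0%nat u = 0.
Proof.
  intros Hu G. pose proof (pos_INR m).
  rewrite <- (hyp2F1_ode ((INR m - /2) / 2 + 1) ((INR m + /2) / 2) (INR m + 1)
    (fun k => / INR (Factorial.fact (m + k))) (inv_fact_S m)
    ltac:(lra) ltac:(lra) ltac:(lra) (fun k => inv_fact_pos (m + k)) u Hu).
  fold (Qhalf_coef m). fold G. field.
Qed.

Definition kernel_domain (s p : R) : Prop := 0 < s /\ Rabs p < s ^ 2.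

Lemma kernel_domain_ratio (s p : R) : kernel_domain s p -> Rabs (p / s ^ 2) < 1.
Proof.
  intros [Hs Hp]. rewrite Rabs_div, (Rabs_pos_eq (s ^ 2)) by nra.
  apply (Rmult_lt_reg_r (s ^ 2)); [nra|].
  unfold Rdiv. rewrite Rmult_assoc, Rinv_l by nra. lra.
Qed.

(* [s ^ (- (m + i + 1/2)) G^(j) (p / s^2)]: the partial derivatives of
   [s ^ (- (m + 1/2)) G (p / s^2)] are combinations of these. *)
Definition kernel_mode (m i j : nat) (s p : R) : R :=
  PSeries_deriv (Qhalf_coef m) j (p / s ^ 2) * neg_half_pow (m + i) s.

Lemma kernel_mode_S (m i j : nat) (s p : R) : s <> 0 ->
  s * kernel_mode m (S i) j s p = kernel_mode m i j s p.
Proof.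
  intros Hs. unfold kernel_mode. rewrite <- plus_n_Sm, <- (neg_half_pow_S (m + i)) by trivial. ring.
Qed.

Lemma is_derive_kernel_mode (m i j : nat) (s p : R -> R) (x ds dp : R) :
  kernel_domain (s x) (p x) -> is_derive s x ds -> is_derive p x dp ->
  is_derive (fun x => kernel_mode m i j (s x) (p x)) x
    (- (INR m + INR i + /2) * kernel_mode m (S i) j (s x) (p x) * ds
     + (kernel_mode m (S (S i)) (S j) (s x) (p x) * dp
        - 2 * p x * kernel_mode m (S (S (S i))) (S j) (s x) (p x) * ds)).
Proof.
  intros Hd Ds Dp. assert (Hs : s x <> 0) by (destruct Hd; lra).
  assert (Dratio : is_derive (fun x => p x / s x ^ 2) x (dp / s x ^ 2 - 2 * p x * ds / s x ^ 3)).
  { auto_derive_hyps; [now rewrite Rmult_1_r; apply Rmult_integral_contrapositive_currified|].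
    field. trivial. }
  assert (DG := is_derive_PSeries_deriv (Qhalf_coef m) j (p x / s x ^ 2)).
  rewrite CV_radius_Qhalf in DG. specialize (DG (kernel_domain_ratio _ _ Hd)).
  evar_last.
  - apply (is_derive_mult_R (fun x => PSeries_deriv (Qhalf_coef m) j (p x / s x ^ 2))
      (fun x => neg_half_pow (m + i) (s x))).
    + exact (is_derive_comp_R _ (fun x => p x / s x ^ 2) x _ _ DG Dratio).
    + exact (is_derive_comp_R _ s x _ _ (is_derive_neg_half_pow (m + i) _ (proj1 Hd)) Ds).
  - unfold kernel_mode. rewrite plus_INR, <- !plus_n_Sm.
    rewrite <- (neg_half_pow_S (m + i)), <- (neg_half_pow_S (S (m + i))),
      <- (neg_half_pow_S (S (S (m + i)))) by trivial.
    cbv beta. field. trivial.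
Qed.

Lemma continuous_kernel_mode {T : UniformSpace} (m i j : nat) (s p : T -> R) (z : T) :
  kernel_domain (s z) (p z) -> continuous s z -> continuous p z ->
  continuous (fun z => kernel_mode m i j (s z) (p z)) z.
Proof.
  intros Hd Cs Cp. apply (continuous_mult (fun z => PSeries_deriv (Qhalf_coef m) j (p z / s z ^ 2))
    (fun z => neg_half_pow (m + i) (s z))).
  - eapply continuous_comp_is_derive.
    + continuity_arith; trivial. destruct Hd. apply pow_nonzero. lra.
    + apply is_derive_PSeries_deriv. rewrite CV_radius_Qhalf. now apply kernel_domain_ratio.
  - eapply continuous_comp_is_derive; [exact Cs|apply is_derive_neg_half_pow, Hd].
Qed.

Section HomogeneousKernel.
Variable m : nat.
Local Notation mode := (kernel_mode m).
Local Notation be := (INR m + /2).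

Definition hom_kernel (s p : R) : R := mode 0 0 s p.
Definition hom_kernel_s (s p : R) : R := - be * mode 1 0 s p - 2 * p * mode 3 1 s p.
Definition hom_kernel_p (s p : R) : R := mode 2 1 s p.
Definition hom_kernel_ss (s p : R) : R :=
  be * (be + 1) * mode 2 0 s p + (4 * be + 6) * p * mode 4 1 s p + 4 * p ^ 2 * mode 6 2 s p.
Definition hom_kernel_sp (s p : R) : R := - (be + 2) * mode 3 1 s p - 2 * p * mode 5 2 s p.
Definition hom_kernel_pp (s p : R) : R := mode 4 2 s p.

Lemma hom_kernel_homogeneous (s p : R) : s <> 0 ->
  s * hom_kernel_ss s p + 2 * p * hom_kernel_sp s p = - (INR m + 3 / 2) * hom_kernel_s s p.
Proof.
  intros Hs. unfold hom_kernel_ss, hom_kernel_sp, hom_kernel_s.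
  rewrite <- (kernel_mode_S m 1), <- (kernel_mode_S m 3), <- (kernel_mode_S m 5) by trivial. field.
Qed.

(* The hypergeometric equation in the variables [s] and [p]. *)
Lemma hom_kernel_pde (s p : R) : kernel_domain s p ->
  hom_kernel_ss s p = 4 * p * hom_kernel_pp s p + 4 * (INR m + 1) * hom_kernel_p s p.
Proof.
  intros Hd. pose proof (Qhalf_ode m _ (kernel_domain_ratio s p Hd)) as ode.
  assert (Hs : s <> 0) by (destruct Hd; lra).
  unfold hom_kernel_ss, hom_kernel_pp, hom_kernel_p.
  rewrite <- !(kernel_mode_S m 2), <- !(kernel_mode_S m 3), <- !(kernel_mode_S m 4),
    <- !(kernel_mode_S m 5) by trivial.
  unfold kernel_mode. cbv zeta in ode.
  set (h := neg_half_pow (m + 6) s). set (G := PSeries_deriv (Qhalf_coef m)) in *.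
  apply Rminus_diag_uniq.
  match type of ode with ?o = 0 => transitivity (- 4 * s ^ 4 * h * o) end;
    [field; trivial|rewrite ode; ring].
Qed.

Section ChainRule.
Variables (s p : R -> R) (x ds dp : R).
Hypotheses (Hd : kernel_domain (s x) (p x)) (Ds : is_derive s x ds) (Dp : is_derive p x dp).

Lemma is_derive_hom_kernel : is_derive (fun x => hom_kernel (s x) (p x)) x
  (hom_kernel_s (s x) (p x) * ds + hom_kernel_p (s x) (p x) * dp).
Proof.
  evar_last; [apply (is_derive_kernel_mode m 0 0 s p x ds dp); trivial|].
  unfold hom_kernel_s, hom_kernel_p. simpl INR. ring.
Qed.

Lemma is_derive_hom_kernel_s : is_derive (fun x => hom_kernel_s (s x) (p x)) x
  (hom_kernel_ss (s x) (p x) * ds + hom_kernel_sp (s x) (p x) * dp).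
Proof.
  pose proof (is_derive_kernel_mode m 1 0 s p x ds dp Hd Ds Dp) as D10.
  pose proof (is_derive_kernel_mode m 3 1 s p x ds dp Hd Ds Dp) as D31.
  unfold hom_kernel_s.
  set (f10 := fun x => mode 1 0 (s x) (p x)) in *. set (f31 := fun x => mode 3 1 (s x) (p x)) in *.
  change (is_derive (fun x => - be * f10 x - 2 * p x * f31 x) x
    (hom_kernel_ss (s x) (p x) * ds + hom_kernel_sp (s x) (p x) * dp)).
  auto_derive_hyps. unfold hom_kernel_ss, hom_kernel_sp, f31. simpl INR. ring.
Qed.

Lemma is_derive_hom_kernel_p : is_derive (fun x => hom_kernel_p (s x) (p x)) x
  (hom_kernel_sp (s x) (p x) * ds + hom_kernel_pp (s x) (p x) * dp).
Proof.
  evar_last; [apply (is_derive_kernel_mode m 2 1 s p x ds dp); trivial|].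
  unfold hom_kernel_sp, hom_kernel_pp. simpl INR. field.
Qed.
End ChainRule.
End HomogeneousKernel.

Definition chi_num (x y a b : R) : R := x ^ 2 + y ^ 2 + a ^ 2 + b ^ 2 - 2 - 2 * x * y * a * b.
Definition chi_num_dx (x y a b : R) : R := 2 * x - 2 * y * a * b.
Definition chi_den2 (x y a b : R) : R := 4 * (1 - x ^ 2) * (1 - y ^ 2) * (1 - a ^ 2) * (1 - b ^ 2).
Definition chi_den2_dx (x y a b : R) : R := - 8 * x * (1 - y ^ 2) * (1 - a ^ 2) * (1 - b ^ 2).
Definition chi_den2_dxx (y a b : R) : R := - 8 * (1 - y ^ 2) * (1 - a ^ 2) * (1 - b ^ 2).

Definition kernel_regular (x y a b : R) : Prop :=
  kernel_domain (chi_num x y a b) (chi_den2 x y a b).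

Definition kernel (m : nat) (x y a b : R) : R := hom_kernel m (chi_num x y a b) (chi_den2 x y a b).

Definition kernel_dx (m : nat) (x y a b : R) : R :=
  let s := chi_num x y a b in let p := chi_den2 x y a b in
  hom_kernel_s m s p * chi_num_dx x y a b + hom_kernel_p m s p * chi_den2_dx x y a b.

Definition kernel_dxx (m : nat) (x y a b : R) : R :=
  let s := chi_num x y a b in let p := chi_den2 x y a b in
  let s1 := chi_num_dx x y a b in let p1 := chi_den2_dx x y a b in
  hom_kernel_ss m s p * s1 ^ 2 + 2 * hom_kernel_sp m s p * s1 * p1 + hom_kernel_pp m s p * p1 ^ 2
  + 2 * hom_kernel_s m s p + hom_kernel_p m s p * chi_den2_dxx y a b.

Lemma chi_num_swap (x y a b : R) : chi_num y x a b = chi_num x y a b.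
Proof. unfold chi_num; ring. Qed.

Lemma chi_num_rot (x y a b : R) : chi_num b x y a = chi_num x y a b.
Proof. unfold chi_num; ring. Qed.

Lemma chi_den2_swap (x y a b : R) : chi_den2 y x a b = chi_den2 x y a b.
Proof. unfold chi_den2; ring. Qed.

Lemma chi_den2_rot (x y a b : R) : chi_den2 b x y a = chi_den2 x y a b.
Proof. unfold chi_den2; ring. Qed.

Lemma kernel_regular_swap (x y a b : R) : kernel_regular x y a b -> kernel_regular y x a b.
Proof. unfold kernel_regular. now rewrite chi_num_swap, chi_den2_swap. Qed.

Lemma kernel_regular_rot (x y a b : R) : kernel_regular x y a b -> kernel_regular b x y a.
Proof. unfold kernel_regular. now rewrite (chi_num_rot x), (chi_den2_rot x). Qed.

Lemma kernel_swap (m : nat) (x y a b : R) : kernel m y x a b = kernel m x y a b.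
Proof. unfold kernel. now rewrite chi_num_swap, chi_den2_swap. Qed.

Lemma kernel_rot (m : nat) (x y a b : R) : kernel m b x y a = kernel m x y a b.
Proof. unfold kernel. now rewrite (chi_num_rot x), (chi_den2_rot x). Qed.

Lemma kernel_swap13 (m : nat) (x y a b : R) : kernel m a y x b = kernel m x y a b.
Proof. unfold kernel. f_equal; unfold chi_num, chi_den2; ring. Qed.

Lemma is_derive_chi_num (x y a b : R) :
  is_derive (fun x => chi_num x y a b) x (chi_num_dx x y a b).
Proof. unfold chi_num, chi_num_dx. auto_derive; trivial. ring. Qed.

Lemma is_derive_chi_den2 (x y a b : R) :
  is_derive (fun x => chi_den2 x y a b) x (chi_den2_dx x y a b).
Proof. unfold chi_den2, chi_den2_dx. auto_derive; trivial. ring. Qed.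

Lemma is_derive_kernel (m : nat) (x y a b : R) : kernel_regular x y a b ->
  is_derive (fun x => kernel m x y a b) x (kernel_dx m x y a b).
Proof.
  intros Hr. apply (is_derive_hom_kernel m (fun x => chi_num x y a b) (fun x => chi_den2 x y a b));
    [exact Hr|apply is_derive_chi_num|apply is_derive_chi_den2].
Qed.

Lemma is_derive_kernel_dx (m : nat) (x y a b : R) : kernel_regular x y a b ->
  is_derive (fun x => kernel_dx m x y a b) x (kernel_dxx m x y a b).
Proof.
  intros Hr.
  pose proof (is_derive_chi_num x y a b) as Ds. pose proof (is_derive_chi_den2 x y a b) as Dp.
  pose proof (is_derive_hom_kernel_s m _ _ x _ _ Hr Ds Dp) as Dhs.
  pose proof (is_derive_hom_kernel_p m _ _ x _ _ Hr Ds Dp) as Dhp.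
  assert (Ds1 : is_derive (fun x => chi_num_dx x y a b) x 2)
    by (unfold chi_num_dx; auto_derive; trivial; ring).
  assert (Dp1 : is_derive (fun x => chi_den2_dx x y a b) x (chi_den2_dxx y a b))
    by (unfold chi_den2_dx, chi_den2_dxx; auto_derive; trivial; ring).
  evar_last.
  - apply @is_derive_plus;
      [exact (is_derive_mult_R _ _ _ _ _ Dhs Ds1)|exact (is_derive_mult_R _ _ _ _ _ Dhp Dp1)].
  - unfold kernel_dxx, plus; simpl. ring.
Qed.

Lemma kernel_gegenbauer_symmetric (m : nat) (x y a b : R) : kernel_regular x y a b ->
  gegenbauer_op m x (kernel_dx m x y a b) (kernel_dxx m x y a b) =
  gegenbauer_op m y (kernel_dx m y x a b) (kernel_dxx m y x a b).
Proof.
  intros Hr. unfold kernel_dxx, kernel_dx. rewrite (chi_num_swap x y), (chi_den2_swap x y).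
  assert (Hs : chi_num x y a b <> 0) by (destruct Hr; lra).
  pose proof (hom_kernel_homogeneous m (chi_num x y a b) (chi_den2 x y a b) Hs) as hom.
  pose proof (hom_kernel_pde m (chi_num x y a b) (chi_den2 x y a b) Hr) as pde.
  cbv zeta. unfold gegenbauer_op.
  set (hs := hom_kernel_s m _ _) in *. set (hp := hom_kernel_p m _ _) in *.
  set (hss := hom_kernel_ss m _ _) in *. set (hsp := hom_kernel_sp m _ _) in *.
  set (hpp := hom_kernel_pp m _ _) in *.
  clearbody hs hp hss hsp hpp.
  apply Rminus_diag_uniq. transitivity (- 4 * (x ^ 2 - y ^ 2) *
    ((chi_num x y a b * hss + 2 * chi_den2 x y a b * hsp - - (INR m + 3 / 2) * hs)
     + (1 - a ^ 2) * (1 - b ^ 2) * (hss - (4 * chi_den2 x y a b * hpp + 4 * (INR m + 1) * hp)))).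
  - unfold chi_num_dx, chi_den2_dx, chi_den2_dxx, chi_num, chi_den2. field.
  - rewrite hom, pde. ring.
Qed.

Section KernelContinuity.
Context {T : UniformSpace} (m : nat) (x y a b : T -> R) (z : T).
Hypotheses (Cx : continuous x z) (Cy : continuous y z) (Ca : continuous a z) (Cb : continuous b z).
Hypothesis Hr : kernel_regular (x z) (y z) (a z) (b z).

Let continuous_mode i j : continuous (fun z => kernel_mode m i j
  (chi_num (x z) (y z) (a z) (b z)) (chi_den2 (x z) (y z) (a z) (b z))) z.
Proof.
  apply (continuous_kernel_mode m i j (fun z => chi_num (x z) (y z) (a z) (b z))
    (fun z => chi_den2 (x z) (y z) (a z) (b z))); trivial;
    unfold chi_num, chi_den2; continuity_arith; trivial.
Qed.

Lemma continuous_kernel : continuous (fun z => kernel m (x z) (y z) (a z) (b z)) z.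
Proof. apply continuous_mode. Qed.

Lemma continuous_kernel_dx : continuous (fun z => kernel_dx m (x z) (y z) (a z) (b z)) z.
Proof.
  unfold kernel_dx, hom_kernel_s, hom_kernel_p. cbv zeta. unfold chi_num_dx, chi_den2_dx.
  continuity_arith; trivial; try apply continuous_mode.
  unfold chi_den2; continuity_arith; trivial.
Qed.

Lemma continuous_kernel_dxx : continuous (fun z => kernel_dxx m (x z) (y z) (a z) (b z)) z.
Proof.
  assert (continuous (fun z => chi_den2 (x z) (y z) (a z) (b z)) z)
    by (unfold chi_den2; continuity_arith; trivial).
  unfold kernel_dxx, hom_kernel_ss, hom_kernel_sp, hom_kernel_pp, hom_kernel_s, hom_kernel_p.
  cbv zeta. unfold chi_num_dx, chi_den2_dx, chi_den2_dxx.
  continuity_arith; trivial; apply continuous_mode.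
Qed.
End KernelContinuity.

(** * Integration against the Legendre weight *)

Definition legendre_weight (m n : nat) (t : R) : R :=
  sin t ^ (2 * m + 1) * legendre_deriv n m (cos t).

Definition legendre_integral (m n : nat) (F : R -> R) : R :=
  RInt (fun t => legendre_weight m n t * F (cos t)) 0 PI.

Lemma continuous_legendre_weight {T : UniformSpace} (m n : nat) (f : T -> R) (z : T) :
  continuous f z -> continuous (fun z => legendre_weight m n (f z)) z.
Proof.
  intros Hf. unfold legendre_weight. continuity_arith; trivial.
  apply continuous_legendre_deriv. now continuity_arith.
Qed.

Lemma continuous_legendre_weight_mult (m n : nat) (F : R -> R) (t : R) :
  continuous F t -> continuous (fun t => legendre_weight m n t * F t) t.
Proof.
  intros HF. apply (continuous_mult (legendre_weight m n) F); trivial.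
  apply continuous_legendre_weight, continuous_id.
Qed.

Lemma legendre_integral_correct (m n : nat) (F : R -> R) :
  (forall t, continuous (fun t => F (cos t)) t) ->
  is_RInt (fun t => legendre_weight m n t * F (cos t)) 0 PI (legendre_integral m n F).
Proof.
  intros HF. apply is_RInt_continuous. intros t.
  apply (continuous_legendre_weight_mult m n (fun t => F (cos t))), HF.
Qed.

Lemma legendre_integral_ext (m n : nat) (F G : R -> R) :
  (forall t, F (cos t) = G (cos t)) -> legendre_integral m n F = legendre_integral m n G.
Proof. intros E. apply RInt_ext. intros t _. now rewrite E. Qed.

Lemma legendre_integral_linear_comb (m n : nat) (F G : R -> R) (u v : R) :
  (forall t, continuous (fun t => F (cos t)) t) -> (forall t, continuous (fun t => G (cos t)) t) ->
  legendre_integral m n (fun x => u * F x + v * G x) =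
  u * legendre_integral m n F + v * legendre_integral m n G.
Proof.
  intros HF HG. apply is_RInt_unique.
  eapply is_RInt_ext; [|exact (is_RInt_linear_comb _ _ _ _ u v _ _
    (legendre_integral_correct m n F HF) (legendre_integral_correct m n G HG))].
  intros t _. simpl. ring.
Qed.

Lemma legendre_integral_scal_r (m n : nat) (F : R -> R) (v : R) :
  (forall t, continuous (fun t => F (cos t)) t) ->
  legendre_integral m n (fun x => F x * v) = legendre_integral m n F * v.
Proof.
  intros HF. transitivity (v * legendre_integral m n F + 0 * legendre_integral m n F); [|ring].
  rewrite <- legendre_integral_linear_comb by trivial.
  apply legendre_integral_ext. intros; ring.
Qed.

Lemma is_derive_legendre_integral_param (m n : nat) (F F1 : R -> R -> R) (z : R) :
  locally z (fun z => forall t, is_derive (fun z => F z (cos t)) z (F1 z (cos t))) ->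
  locally z (fun z => forall t, continuous (fun t => F z (cos t)) t) ->
  (forall t, continuous (fun p : R * R => F1 (fst p) (cos (snd p))) (z, t)) ->
  is_derive (fun z => legendre_integral m n (F z)) z (legendre_integral m n (F1 z)).
Proof.
  intros DF CF CF1.
  apply (is_derive_RInt_param_continuous (fun z t => legendre_weight m n t * F z (cos t))
    (fun z t => legendre_weight m n t * F1 z (cos t))).
  - apply filter_imp with (2 := DF). intros y Hy t.
    now apply (is_derive_scal (fun z => F z (cos t))).
  - apply filter_imp with (2 := CF). intros y Hy t.
    apply (continuous_legendre_weight_mult m n (fun t => F y (cos t))), Hy.
  - intros t. apply (continuous_mult (fun p => legendre_weight m n (snd p))); [|apply CF1].
    apply continuous_legendre_weight, continuous_snd.
Qed.

(* Green's first identity for the operator [gegenbauer_op m], which is formally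
   [(1 - x^2)^(-m) D (1 - x^2)^(m+1) D]. *)
Lemma gegenbauer_green (m : nat) (f1 f2 g g1 : R -> R) :
  (forall t, is_derive f1 (cos t) (f2 (cos t))) -> (forall t, is_derive g (cos t) (g1 (cos t))) ->
  (forall t, continuous (fun t => f2 (cos t)) t) ->
  (forall t, continuous (fun t => g1 (cos t)) t) ->
  is_RInt (fun t => sin t ^ (2 * m + 1) *
    (gegenbauer_op m (cos t) (f1 (cos t)) (f2 (cos t)) * g (cos t)
     + sin t ^ 2 * (f1 (cos t) * g1 (cos t)))) 0 PI 0.
Proof.
  intros Df1 Dg Cf2 Cg1.
  set (F := fun t => - sin t ^ (2 * m + 2) * (f1 (cos t) * g (cos t))).
  replace 0 with (F PI - F 0) at 2
    by (unfold F; rewrite sin_PI, sin_0, pow_i by lia; ring).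
  apply is_RInt_primitive; intros t.
  - pose proof (is_derive_comp_cos f1 t _ (Df1 t)) as D1.
    pose proof (is_derive_comp_cos g t _ (Dg t)) as D.
    unfold F. set (f1c := fun t => f1 (cos t)) in *. set (gc := fun t => g (cos t)) in *.
    change (is_derive (fun t => - sin t ^ (2 * m + 2) * (f1c t * gc t)) t
      (sin t ^ (2 * m + 1) * (gegenbauer_op m (cos t) (f1c t) (f2 (cos t)) * gc t
        + sin t ^ 2 * (f1c t * g1 (cos t))))).
    auto_derive_hyps.
    unfold gegenbauer_op. rewrite <- sin_pow2.
    change (m + (m + 0))%nat with (2 * m)%nat.
    replace (Init.Nat.pred (2 * m + 2)) with (2 * m + 1)%nat by lia.
    replace (2 * m + 2)%nat with (S (2 * m + 1)) by lia.
    rewrite S_INR, plus_INR, mult_INR. simpl. ring.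
  - pose proof (continuous_comp_cos f1 t _ (Df1 t)). pose proof (continuous_comp_cos g t _ (Dg t)).
    unfold gegenbauer_op. continuity_arith; trivial; apply Cf2 || apply Cg1.
Qed.

Lemma legendre_integral_by_parts (m n : nat) (f f1 : R -> R) :
  (forall t, is_derive f (cos t) (f1 (cos t))) -> (forall t, continuous (fun t => f1 (cos t)) t) ->
  legendre_integral (S m) n f1 = legendre_eigenvalue m n * legendre_integral m n f.
Proof.
  intros Df Cf1.
  assert (Cf : forall t, continuous (fun t => f (cos t)) t)
    by (intros t; apply (continuous_comp_cos f t _ (Df t))).
  apply Rminus_diag_uniq. eapply is_RInt_eq.
  - apply @is_RInt_minus; [now apply legendre_integral_correct|].
    apply @is_RInt_scal. now apply legendre_integral_correct.
  - eapply is_RInt_ext; [|apply (gegenbauer_green m (legendre_deriv n (S m))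
      (legendre_deriv n (S (S m))) f f1); trivial].
    + intros t _. unfold legendre_weight, minus, plus, opp, scal; simpl; unfold mult; simpl.
      replace (gegenbauer_op m (cos t) (legendre_deriv n (S m) (cos t))
          (legendre_deriv n (S (S m)) (cos t)))
        with (- (legendre_eigenvalue m n * legendre_deriv n m (cos t)))
        by (pose proof (legendre_deriv_ode n m (cos t)); lra).
      replace (m + S (m + 0) + 1)%nat with (S (m + (m + 0) + 1)) by lia. simpl. ring.
    + intros t. apply is_derive_legendre_deriv.
    + intros t. apply continuous_legendre_deriv, continuous_cos.
Qed.

Lemma legendre_integral_gegenbauer (m n : nat) (f f1 f2 : R -> R) :
  (forall t, is_derive f (cos t) (f1 (cos t))) -> (forall t, is_derive f1 (cos t) (f2 (cos t))) ->
  (forall t, continuous (fun t => f2 (cos t)) t) ->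
  legendre_integral m n (fun x => gegenbauer_op m x (f1 x) (f2 x)) =
  - legendre_eigenvalue m n * legendre_integral m n f.
Proof.
  intros Df Df1 Cf2.
  assert (Cf1 : forall t, continuous (fun t => f1 (cos t)) t)
    by (intros t; apply (continuous_comp_cos f1 t _ (Df1 t))).
  rewrite Ropp_mult_distr_l_reverse, <- (legendre_integral_by_parts m n f f1) by trivial.
  apply Rplus_opp_r_uniq. eapply is_RInt_eq.
  - apply @is_RInt_plus; [now apply legendre_integral_correct|].
    apply legendre_integral_correct. intros t. unfold gegenbauer_op.
    continuity_arith; apply Cf1 || apply Cf2.
  - eapply is_RInt_ext; [|apply (gegenbauer_green m f1 f2 (legendre_deriv n m)
      (legendre_deriv n (S m))); trivial].
    + intros t _. unfold legendre_weight, plus; simpl.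
      replace (m + S (m + 0) + 1)%nat with (S (m + (m + 0) + 1)) by lia. simpl. ring.
    + intros t. apply is_derive_legendre_deriv.
    + intros t. apply continuous_legendre_deriv, continuous_cos.
Qed.

(** * Separation of variables *)

Definition kernel_integral (m n : nat) (y a b : R) : R :=
  legendre_integral m n (fun x => kernel m y x a b).

Lemma kernel_integral_gegenbauer (m n : nat) (y a b : R) :
  (forall t, kernel_regular y (cos t) a b) ->
  gegenbauer_op m y (legendre_integral m n (fun x => kernel_dx m y x a b))
    (legendre_integral m n (fun x => kernel_dxx m y x a b))
  + legendre_eigenvalue m n * kernel_integral m n y a b = 0.
Proof.
  intros Hy. assert (Hy' : forall t, kernel_regular (cos t) y a b)
    by (intros; now apply kernel_regular_swap).
  assert (Hop : legendre_integral m n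
      (fun x => gegenbauer_op m x (kernel_dx m x y a b) (kernel_dxx m x y a b)) =
    gegenbauer_op m y (legendre_integral m n (fun x => kernel_dx m y x a b))
      (legendre_integral m n (fun x => kernel_dxx m y x a b))).
  { transitivity (legendre_integral m n (fun x => (1 - y ^ 2) * kernel_dxx m y x a b
      + - (2 * (INR m + 1) * y) * kernel_dx m y x a b)).
    - apply legendre_integral_ext. intros t.
      rewrite kernel_gegenbauer_symmetric by trivial. unfold gegenbauer_op. ring.
    - rewrite legendre_integral_linear_comb; [unfold gegenbauer_op; ring| |]; intros t.
      + apply continuous_kernel_dxx; trivial; continuity_arith.
      + apply continuous_kernel_dx; trivial; continuity_arith. }
  rewrite <- Hop, (legendre_integral_gegenbauer m n (fun x => kernel m x y a b)).
  - unfold kernel_integral. rewrite (legendre_integral_ext m n (fun x => kernel m x y a b)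
      (fun x => kernel m y x a b)) by (intros; apply kernel_swap). ring.
  - intros t. now apply is_derive_kernel.
  - intros t. now apply is_derive_kernel_dx.
  - intros t. apply continuous_kernel_dxx; trivial; continuity_arith.
Qed.

(* [q] may be singular at [0]. *)
Definition regular_solution (q : R -> R) (la L : R) (v : R -> R) : Prop :=
  exists v1 : R -> R, v1 0 = 0 /\ continuous v1 0 /\
    (forall t, 0 <= t < L -> is_derive v t (v1 t)) /\
    (forall t, 0 < t < L -> is_derive v1 t (- q t * v1 t + la * v t)).

Lemma energy_rate_le (M q la x y : R) : - M <= q ->
  2 * x * y + 2 * y * (- q * y + la * x) <= (Rabs (1 + la) + 2 * Rabs M) * (x ^ 2 + y ^ 2).
Proof.
  intros Hq. pose proof (pow2_ge_0 x). pose proof (pow2_ge_0 y).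
  assert (Hdrift : - 2 * q * y ^ 2 <= 2 * Rabs M * (x ^ 2 + y ^ 2))
    by (pose proof (Rle_abs M); pose proof (Rabs_pos M); nra).
  assert (Hcross : 2 * (1 + la) * (x * y) <= Rabs (1 + la) * (x ^ 2 + y ^ 2)).
  { pose proof (pow2_ge_0 (x + y)). pose proof (pow2_ge_0 (x - y)).
    unfold Rabs. destruct (Rcase_abs (1 + la)); nra. }
  lra.
Qed.

(* The energy [v^2 + v1^2], damped by [exp (- C t)], is nonincreasing and starts at 0. *)
Lemma regular_solution_eq_0 (q v : R -> R) (la L M : R) : regular_solution q la L v -> v 0 = 0 ->
  (forall t, 0 < t < L -> - M <= q t) -> forall t, 0 <= t < L -> v t = 0.
Proof.
  intros [v1 [v1_0 [Cv1 [Dv Dv1]]]] v_0 Hq t Ht.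
  set (C := Rabs (1 + la) + 2 * Rabs M).
  set (E := fun t => (v t ^ 2 + v1 t ^ 2) * exp (- C * t)).
  set (E1 := fun t => (2 * v t * v1 t + 2 * v1 t * (- q t * v1 t + la * v t)
     - C * (v t ^ 2 + v1 t ^ 2)) * exp (- C * t)).
  destruct (Req_dec t 0) as [->|Ht0]; trivial.
  assert (E_0 : E 0 = 0) by (unfold E; rewrite v_0, v1_0; ring).
  assert (HE : E t <= E 0).
  { destruct (MVT_gen E 0 t E1) as [z [Hz HE]]; rewrite Rmin_left, Rmax_right in * by lra.
    - intros z Hz. pose proof (Dv z ltac:(lra)). pose proof (Dv1 z ltac:(lra)).
      unfold E, E1. auto_derive_hyps. ring.
    - intros z Hz. apply continuity_pt_filterlim. change (continuous E z). unfold E.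
      assert (continuous v z)
        by (apply @ex_derive_continuous; eexists; apply Dv; lra).
      assert (continuous v1 z).
      { destruct (Req_dec z 0) as [->|]; trivial.
        apply @ex_derive_continuous. eexists. apply Dv1; lra. }
      continuity_arith; trivial.
    - assert (E1 z <= 0); [|nra].
      unfold E1. pose proof (exp_pos (- C * z)).
      destruct (Req_dec z 0) as [->|]; [rewrite v_0, v1_0; lra|].
      pose proof (energy_rate_le M (q z) la (v z) (v1 z) ltac:(apply Hq; lra)) as HC.
      fold C in HC. nra. }
  rewrite E_0 in HE. unfold E in HE. pose proof (exp_pos (- C * t)).
  assert (v t ^ 2 + v1 t ^ 2 <= 0) by nra. pose proof (pow2_ge_0 (v1 t)). nra.
Qed.

Lemma regular_solution_proportional (q u v : R -> R) (la L M : R) :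
  regular_solution q la L u -> regular_solution q la L v ->
  (forall t, 0 < t < L -> - M <= q t) ->
  forall t, 0 <= t < L -> u t * v 0 = v t * u 0.
Proof.
  intros [u1 [u1_0 [Cu1 [Du Du1]]]] [v1 [v1_0 [Cv1 [Dv Dv1]]]] Hq t Ht.
  apply Rminus_diag_uniq.
  apply (regular_solution_eq_0 q (fun t => u t * v 0 - v t * u 0) la L M); trivial; [|ring].
  exists (fun t => u1 t * v 0 - v1 t * u 0). split; [|split; [|split; intros z Hz]].
  - rewrite u1_0, v1_0. ring.
  - now continuity_arith.
  - specialize (Du z Hz). specialize (Dv z Hz). auto_derive_hyps. ring.
  - specialize (Du1 z Hz). specialize (Dv1 z Hz). auto_derive_hyps. ring.
Qed.

(* For [c = cos], [eps = 1] and for [c = cosh], [eps = -1]: in the variable [tau] of [y = c tau]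
   the singular point [y = 1] of the Gegenbauer equation becomes an interior point. *)
Section PolarVariable.
Variables (m n : nat) (eps L M : R) (c c1 : R -> R).
Hypotheses (c_0 : c 0 = 1)
  (is_derive_c : forall tau, is_derive c tau (c1 tau))
  (is_derive_c1 : forall tau, is_derive c1 tau (- eps * c tau))
  (c1_pow2 : forall tau, c1 tau ^ 2 = eps * (1 - c tau ^ 2))
  (c1_neq_0 : forall tau, 0 < tau < L -> c1 tau <> 0).

Definition polar_drift (tau : R) : R := (2 * INR m + 1) * (- eps * c tau / c1 tau).

Lemma gegenbauer_polar (la : R) (u u1 u2 : R -> R) :
  (forall tau, 0 <= tau < L -> is_derive (fun tau => u (c tau)) tau (u1 (c tau) * c1 tau)) ->
  (forall tau, 0 <= tau < L -> is_derive (fun tau => u1 (c tau)) tau (u2 (c tau) * c1 tau)) ->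
  (forall tau, 0 <= tau < L ->
    gegenbauer_op m (c tau) (u1 (c tau)) (u2 (c tau)) + la * u (c tau) = 0) ->
  0 < L -> regular_solution polar_drift (- eps * la) L (fun tau => u (c tau)).
Proof.
  intros Du Du1 ode HL.
  assert (Dv1 : forall tau, 0 <= tau < L -> is_derive (fun tau => u1 (c tau) * c1 tau) tau
    (u2 (c tau) * c1 tau * c1 tau + u1 (c tau) * (- eps * c tau))).
  { intros tau Htau. apply (is_derive_mult_R (fun tau => u1 (c tau)) c1); auto. }
  exists (fun tau => u1 (c tau) * c1 tau). split; [|split; [|split; trivial]].
  - assert (c1 0 = 0) as ->; [|ring].
    apply Rsqr_0_uniq. rewrite Rsqr_pow2, c1_pow2, c_0. ring.
  - apply @ex_derive_continuous. eexists. apply Dv1. lra.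
  - intros tau Htau. evar_last; [apply Dv1; lra|].
    specialize (ode tau ltac:(lra)). specialize (c1_neq_0 tau Htau).
    unfold gegenbauer_op in ode. unfold polar_drift.
    transitivity (u2 (c tau) * c1 tau ^ 2 - eps * c tau * u1 (c tau)); [simpl; ring|].
    rewrite c1_pow2.
    transitivity (eps * ((1 - c tau ^ 2) * u2 (c tau)) - eps * c tau * u1 (c tau)); [ring|].
    replace ((1 - c tau ^ 2) * u2 (c tau))
      with (2 * (INR m + 1) * c tau * u1 (c tau) - la * u (c tau)) by lra.
    field. trivial.
Qed.

Lemma legendre_deriv_polar : 0 < L ->
  regular_solution polar_drift (- eps * legendre_eigenvalue m n) L
    (fun tau => legendre_deriv n m (c tau)).
Proof.
  apply (gegenbauer_polar _ _ (legendre_deriv n (S m)) (legendre_deriv n (S (S m))));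
    intros tau _.
  - apply is_derive_comp_R; [apply is_derive_legendre_deriv|apply is_derive_c].
  - apply is_derive_comp_R; [apply is_derive_legendre_deriv|apply is_derive_c].
  - apply legendre_deriv_ode.
Qed.

Variables (a b : R).
Hypothesis kernel_regular_c :
  forall tau, Rabs tau < L -> forall t, kernel_regular (c tau) (cos t) a b.

Let locally_kernel_regular tau : Rabs tau < L ->
  locally tau (fun z => forall t, kernel_regular (c z) (cos t) a b).
Proof.
  intros Htau. assert (Hd : 0 < L - Rabs tau) by lra.
  exists (mkposreal _ Hd). intros z Hz. apply kernel_regular_c.
  change (Rabs (z - tau) < L - Rabs tau) in Hz. pose proof (Rabs_triang_inv z tau). lra.
Qed.

Let continuous_c {T : UniformSpace} (f : T -> R) z :
  continuous f z -> continuous (fun z => c (f z)) z.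
Proof. intros Hf. eapply continuous_comp_is_derive; [exact Hf|apply is_derive_c]. Qed.

Let is_derive_integral_comp (F F1 : R -> R -> R) tau : Rabs tau < L ->
  (forall y x, kernel_regular y x a b -> is_derive (fun y => F y x) y (F1 y x)) ->
  (forall y t, kernel_regular y (cos t) a b -> continuous (fun t => F y (cos t)) t) ->
  (forall t, continuous (fun p : R * R => F1 (c (fst p)) (cos (snd p))) (tau, t)) ->
  (forall t, continuous (fun t => F1 (c tau) (cos t)) t) ->
  is_derive (fun tau => legendre_integral m n (F (c tau))) tau
    (legendre_integral m n (F1 (c tau)) * c1 tau).
Proof.
  intros Htau DF CF CF1 CF1t. rewrite <- legendre_integral_scal_r by trivial.
  apply (is_derive_legendre_integral_param m n (fun tau => F (c tau))
    (fun tau x => F1 (c tau) x * c1 tau)).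
  - apply filter_imp with (2 := locally_kernel_regular tau Htau). intros z Hz t.
    apply (is_derive_comp_R (fun y => F y (cos t)) c); auto.
  - apply filter_imp with (2 := locally_kernel_regular tau Htau). intros z Hz t. auto.
  - intros t. apply (continuous_mult (fun p => F1 (c (fst p)) (cos (snd p)))); [apply CF1|].
    eapply continuous_comp_is_derive; [apply continuous_fst|apply is_derive_c1].
Qed.

Lemma kernel_integral_polar : 0 < L ->
  regular_solution polar_drift (- eps * legendre_eigenvalue m n) L
    (fun tau => kernel_integral m n (c tau) a b).
Proof.
  assert (Habs : forall tau, 0 <= tau < L -> Rabs tau < L)
    by (intros; rewrite Rabs_pos_eq; lra).
  apply (gegenbauer_polar _ (fun y => kernel_integral m n y a b)
    (fun y => legendre_integral m n (fun x => kernel_dx m y x a b))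
    (fun y => legendre_integral m n (fun x => kernel_dxx m y x a b))); intros tau Htau.
  - apply (is_derive_integral_comp (fun y x => kernel m y x a b)
      (fun y x => kernel_dx m y x a b)); auto.
    + intros y x. apply is_derive_kernel.
    + intros y t Hy. apply continuous_kernel; trivial; continuity_arith.
    + intros t. apply (continuous_kernel_dx m (fun p => c (fst p)) (fun p => cos (snd p)));
        [apply continuous_c, continuous_fst|continuity_arith ..|apply kernel_regular_c; auto].
    + intros t. apply continuous_kernel_dx; [continuity_arith ..|apply kernel_regular_c; auto].
  - apply (is_derive_integral_comp (fun y x => kernel_dx m y x a b)
      (fun y x => kernel_dxx m y x a b)); auto.
    + intros y x. apply is_derive_kernel_dx.
    + intros y t Hy. apply continuous_kernel_dx; trivial; continuity_arith.
    + intros t. apply (continuous_kernel_dxx m (fun p => c (fst p)) (fun p => cos (snd p)));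
        [apply continuous_c, continuous_fst|continuity_arith ..|apply kernel_regular_c; auto].
    + intros t. apply continuous_kernel_dxx; [continuity_arith ..|apply kernel_regular_c; auto].
  - apply kernel_integral_gegenbauer. apply kernel_regular_c; auto.
Qed.

Lemma kernel_integral_separate (tau : R) : (forall t, 0 < t < L -> - M <= polar_drift t) ->
  0 <= tau < L ->
  kernel_integral m n (c tau) a b * legendre_deriv n m 1 =
  legendre_deriv n m (c tau) * kernel_integral m n 1 a b.
Proof.
  intros Hdrift Htau. rewrite <- c_0.
  apply (regular_solution_proportional polar_drift
    (fun tau => kernel_integral m n (c tau) a b) (fun tau => legendre_deriv n m (c tau))
    (- eps * legendre_eigenvalue m n) L M); trivial.
  - apply kernel_integral_polar. lra.
  - apply legendre_deriv_polar. lra.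
Qed.
End PolarVariable.

(** * Moments of the Legendre weight and Neumann's integral *)

Definition legendre_moment (m n j : nat) : R := legendre_integral m n (fun x => x ^ j).

Lemma is_RInt_legendre_moment (m n j : nat) :
  is_RInt (fun t => legendre_weight m n t * cos t ^ j) 0 PI (legendre_moment m n j).
Proof. apply (legendre_integral_correct m n (fun x => x ^ j)). intros; continuity_arith. Qed.

Lemma legendre_moment_rec (m d j : nat) :
  INR j * INR (pred j) * legendre_moment m (m + d) (pred (pred j)) =
  (INR j - INR d) * (INR j + INR d + 2 * INR m + 1) * legendre_moment m (m + d) j.
Proof.
  set (f1 := fun x => INR j * x ^ pred j).
  set (f2 := fun x => INR j * (INR (pred j) * x ^ pred (pred j))).
  assert (H : legendre_integral m (m + d) (fun x => gegenbauer_op m x (f1 x) (f2 x)) =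
    - (INR d * (INR d + 2 * INR m + 1)) * legendre_moment m (m + d) j).
  { rewrite <- legendre_eigenvalue_add. apply legendre_integral_gegenbauer; intros t.
    - apply is_derive_pow_n.
    - apply (is_derive_scal (fun x => x ^ pred j)), is_derive_pow_n.
    - unfold f2. continuity_arith. }
  rewrite (legendre_integral_ext m (m + d) _ (fun x => INR j * INR (pred j) * x ^ pred (pred j)
    + - (INR j * (INR j + 2 * INR m + 1)) * x ^ j)) in H.
  - rewrite legendre_integral_linear_comb in H by (intros; continuity_arith).
    fold (legendre_moment m (m + d) j) (legendre_moment m (m + d) (pred (pred j))) in H. lra.
  - intros t. unfold gegenbauer_op, f1, f2.
    destruct j as [|[|j]]; cbn [pred]; rewrite ?S_INR; simpl; ring.
Qed.

Lemma legendre_moment_eq_0 (m d j : nat) : (forall k, j <> d + 2 * k)%nat ->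
  legendre_moment m (m + d) j = 0.
Proof.
  induction j as [j IH] using lt_wf_ind. intros Hj.
  pose proof (legendre_moment_rec m d j) as Hrec.
  replace (INR j * INR (pred j) * legendre_moment m (m + d) (pred (pred j))) with 0 in Hrec.
  - pose proof (pos_INR m). pose proof (pos_INR d). pose proof (pos_INR j).
    assert (INR j <> INR d) by (intros E; apply INR_eq in E; specialize (Hj 0%nat); lia).
    apply (Rmult_eq_reg_l ((INR j - INR d) * (INR j + INR d + 2 * INR m + 1)));
      [rewrite <- Hrec; ring|].
    apply Rmult_integral_contrapositive_currified; lra.
  - destruct j as [|[|j]]; [simpl; ring..|].
    cbn [pred]. rewrite IH; [ring|lia|]. intros k. specialize (Hj (S k)). lia.
Qed.

Lemma legendre_moment_ratio (m d k : nat) :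
  2 * (INR k + 1) * (2 * INR (m + d) + 2 * INR k + 3) * legendre_moment m (m + d) (d + 2 * S k) =
  (INR d + 2 * INR k + 2) * (INR d + 2 * INR k + 1) * legendre_moment m (m + d) (d + 2 * k).
Proof.
  pose proof (legendre_moment_rec m d (d + 2 * S k)) as Hrec.
  replace (pred (pred (d + 2 * S k))) with (d + 2 * k)%nat in Hrec by lia.
  replace (pred (d + 2 * S k)) with (S (d + 2 * k)) in Hrec by lia.
  rewrite (S_INR (d + 2 * k)), !plus_INR, !mult_INR, (S_INR k) in Hrec.
  change (INR 2) with 2 in Hrec.
  rewrite plus_INR. lra.
Qed.

Lemma legendre_moment_succ_order (m n : nat) : (m < n)%nat ->
  legendre_moment (S m) n (n - S m) = (INR n + INR m + 1) * legendre_moment m n (n - m).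
Proof.
  intros Hmn. assert (Hn : INR (n - m) = INR n - INR m) by (apply minus_INR; lia).
  apply (Rmult_eq_reg_r (INR (n - m))); [|apply not_0_INR; lia].
  unfold legendre_moment at 1.
  rewrite <- legendre_integral_scal_r by (intros; continuity_arith).
  rewrite (legendre_integral_by_parts m n (fun x => x ^ (n - m))).
  - fold (legendre_moment m n (n - m)). unfold legendre_eigenvalue. rewrite Hn. ring.
  - intros t. evar_last; [apply is_derive_pow_n|].
    replace (pred (n - m)) with (n - S m)%nat by lia. ring.
  - intros t. continuity_arith.
Qed.

Lemma legendre_moment_0_0_0 : legendre_moment 0 0 0 = 2.
Proof.
  eapply is_RInt_eq; [apply is_RInt_legendre_moment|].
  replace 2 with (- cos PI - - cos 0) by (rewrite cos_PI, cos_0; ring).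
  eapply is_RInt_ext; [|apply (is_RInt_primitive sin (fun t => - cos t))].
  - intros t _. unfold legendre_weight, legendre_deriv. simpl. ring.
  - intros t. auto_derive; trivial. ring.
  - apply continuous_sin.
Qed.

Lemma legendre_moment_diag_S (n : nat) :
  (2 * INR n + 3) * legendre_moment 0 (S n) (S n) = (INR n + 1) * legendre_moment 0 n n.
Proof.
  assert (orthogonality : legendre_moment 0 (S (S n)) n = 0)
    by (apply (legendre_moment_eq_0 0 (S (S n)) n); intros k; lia).
  apply Rminus_diag_uniq. transitivity ((INR n + 2) * legendre_moment 0 (S (S n)) n);
    [|rewrite orthogonality; ring].
  rewrite Rminus_def, <- Ropp_mult_distr_l_reverse. eapply is_RInt_eq.
  - apply is_RInt_linear_comb; apply is_RInt_legendre_moment.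
  - eapply is_RInt_ext; [|apply (is_RInt_scal (fun t => legendre_weight 0 (S (S n)) t * cos t ^ n)),
      is_RInt_legendre_moment].
    intros t _. unfold scal; simpl; unfold mult; simpl. unfold legendre_weight.
    rewrite legendre_deriv_SS. simpl. field. pose proof (pos_INR n); lra.
Qed.

Lemma legendre_moment_diag (n : nat) :
  legendre_moment 0 n n = INR (Factorial.fact n) * sqrt PI / (2 ^ n * gamma_half (n + 1)).
Proof.
  pose proof (sqrt_lt_R0 PI PI_RGT_0).
  induction n as [|n IH]; [rewrite legendre_moment_0_0_0; simpl; field; lra|].
  pose proof (pos_INR n). apply (Rmult_eq_reg_l (2 * INR n + 3)); [|lra].
  rewrite legendre_moment_diag_S, IH, fact_simpl, mult_INR, !Nat.add_1_r.
  rewrite (gamma_half_S (S n)), S_INR. simpl pow. pose proof (gamma_half_pos (S n)).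
  assert (0 < 2 ^ n) by (apply pow_lt; lra). field. repeat split; lra.
Qed.

Lemma legendre_moment_leading (m n : nat) : (m <= n)%nat -> legendre_moment m n (n - m) =
  INR (Factorial.fact (n + m)) * sqrt PI / (2 ^ n * gamma_half (n + 1)).
Proof.
  induction m as [|m IH]; intros Hmn.
  - rewrite Nat.sub_0_r, Nat.add_0_r. apply legendre_moment_diag.
  - rewrite legendre_moment_succ_order, IH by lia.
    rewrite <- (plus_n_Sm n m), fact_simpl, mult_INR, S_INR, plus_INR.
    field. split; [pose proof (gamma_half_pos (n + 1)); lra|]. apply pow_nonzero; lra.
Qed.

Definition Q_coef (m n : nat) : nat -> R :=
  hyp2F1_coef ((INR n + INR m) / 2 + 1) ((INR n + INR m + 1) / 2)
    (fun k => / gamma_half (n + k + 1)).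

Lemma inv_gamma_half_S (n k : nat) :
  / gamma_half (n + k + 1) = (INR n + 3 / 2 + INR k) * / gamma_half (n + S k + 1).
Proof.
  replace (n + S k + 1)%nat with (S (n + k + 1)) by lia.
  rewrite gamma_half_S, !plus_INR. change (INR 1) with 1.
  pose proof (pos_INR n). pose proof (pos_INR k). pose proof (gamma_half_pos (n + k + 1)).
  field. lra.
Qed.

Lemma CV_radius_Q (m n : nat) : CV_radius (Q_coef m n) = 1.
Proof.
  pose proof (pos_INR m). pose proof (pos_INR n).
  apply (CV_radius_hyp2F1 _ _ (INR n + 3 / 2)); try lra; [apply inv_gamma_half_S|].
  intros k. apply Rinv_0_lt_compat, gamma_half_pos.
Qed.

Lemma binom_moment_S (m d k : nat) :
  let c := fun k =>
    binom_coef (2 * INR m + 1) (d + 2 * k) * legendre_moment m (m + d) (d + 2 * k) in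
  (INR k + 1) * (INR (m + d) + 3 / 2 + INR k) * c (S k) =
  ((INR (m + d) + INR m) / 2 + 1 + INR k) * ((INR (m + d) + INR m + 1) / 2 + INR k) * c k.
Proof.
  cbv zeta.
  pose proof (legendre_moment_ratio m d k) as Hmoment.
  pose proof (binom_coef_S (2 * INR m + 1) (d + 2 * k)) as Hbinom.
  pose proof (binom_coef_S (2 * INR m + 1) (S (d + 2 * k))) as HbinomS.
  replace (S (S (d + 2 * k))) with (d + 2 * S k)%nat in HbinomS by lia.
  rewrite S_INR in HbinomS. rewrite plus_INR, mult_INR in Hbinom, HbinomS.
  change (INR 2) with 2 in Hbinom, HbinomS. rewrite plus_INR in *.
  pose proof (pos_INR d). pose proof (pos_INR k).
  set (b0 := binom_coef _ (d + 2 * k)) in *. set (b1 := binom_coef _ (S (d + 2 * k))) in *.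
  set (b2 := binom_coef _ (d + 2 * S k)) in *.
  set (mu0 := legendre_moment _ _ (d + 2 * k)) in *.
  set (mu2 := legendre_moment _ _ (d + 2 * S k)) in *.
  set (D := INR d) in *. set (K := INR k) in *. set (M := INR m) in *.
  clearbody b0 b1 b2 mu0 mu2 D K M.
  apply (Rmult_eq_reg_l (4 * (D + 2 * K + 2) * (D + 2 * K + 1)));
    [|repeat apply Rmult_integral_contrapositive_currified; lra].
  transitivity ((2 * (K + 1) * (2 * (M + D) + 2 * K + 3) * mu2) * ((D + 2 * K + 1 + 1) * b2)
    * (D + 2 * K + 1)); [field|].
  rewrite Hmoment, HbinomS.
  transitivity ((D + 2 * K + 2) * (D + 2 * K + 1) * mu0 * (2 * M + 1 + (D + 2 * K + 1))
    * ((D + 2 * K + 1) * b1)); [ring|].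
  rewrite Hbinom. field.
Qed.

Lemma binom_moment_Q_coef (m d k : nat) :
  binom_coef (2 * INR m + 1) (d + 2 * k) * legendre_moment m (m + d) (d + 2 * k) =
  binom_coef (2 * INR m + 1) d * legendre_moment m (m + d) d * gamma_half (m + d + 1)
  * Q_coef m (m + d) k.
Proof.
  induction k as [|k IH].
  - rewrite Nat.mul_0_r, Nat.add_0_r. unfold Q_coef, hyp2F1_coef. rewrite Nat.add_0_r. simpl.
    field. pose proof (gamma_half_pos (m + d + 1)). lra.
  - pose proof (pos_INR k). pose proof (pos_INR (m + d)).
    apply (Rmult_eq_reg_l ((INR k + 1) * (INR (m + d) + 3 / 2 + INR k)));
      [|apply Rmult_integral_contrapositive_currified; lra].
    rewrite binom_moment_S, IH. set (C := binom_coef _ d * _ * _).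
    transitivity (C * ((INR k + 1) * (INR (m + d) + 3 / 2 + INR k) * Q_coef m (m + d) (S k)));
      [|ring].
    unfold Q_coef. rewrite (hyp2F1_coef_S _ _ _ _ (inv_gamma_half_S (m + d)) k). ring.
Qed.

Lemma PSeries_support (a : nat -> R) (d : nat) (x : R) :
  (forall j, (forall k, j <> d + 2 * k)%nat -> a j = 0) ->
  ex_pseries (fun k => a (d + 2 * k)%nat) (x ^ 2) ->
  PSeries a x = x ^ d * PSeries (fun k => a (d + 2 * k)%nat) (x ^ 2).
Proof.
  intros Ha Hex.
  assert (Hodd : forall k, PS_decr_n a d (2 * k + 1)%nat = 0) by (intros k; apply Ha; lia).
  rewrite (PSeries_decr_n_aux a d) by (intros; apply Ha; lia). f_equal.
  rewrite PSeries_odd_even; trivial.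
  - rewrite (PSeries_ext _ (fun _ => 0) _ Hodd), PSeries_const_0. unfold PS_decr_n. ring.
  - apply (ex_pseries_ext (fun _ => 0)); [intros; now rewrite Hodd|].
    apply CV_radius_inside. now rewrite CV_radius_const_0.
Qed.

Lemma legendre_integral_neumann_series (m n : nat) (r : R) : 0 <= r < 1 ->
  legendre_integral m n (fun x => / (1 - r * x) ^ (2 * m + 1)) =
  PSeries (fun k => binom_coef (2 * INR m + 1) k * legendre_moment m n k) r.
Proof.
  intros Hr. pose proof (pos_INR m).
  assert (Hcos : forall t, Rabs (r * cos t) <= r).
  { intros t. rewrite Rabs_mult, (Rabs_pos_eq r) by lra.
    assert (Rabs (cos t) <= 1) by (apply Rabs_le, COS_bound). pose proof (Rabs_pos (cos t)). nra. }
  symmetry. apply is_series_unique.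
  assert (Hint : legendre_integral m n (fun x => / (1 - r * x) ^ (2 * m + 1)) =
    RInt (fun t => legendre_weight m n t * PSeries (binom_coef (2 * INR m + 1)) (r * cos t)) 0 PI).
  { apply RInt_ext. intros t _.
    replace (2 * INR m) with (INR (2 * m)) by now rewrite mult_INR.
    rewrite PSeries_binom_pow; trivial. specialize (Hcos t). lra. }
  rewrite Hint.
  eapply is_series_ext; [|apply (is_series_RInt_PSeries (legendre_weight m n) (fun t => r * cos t)
    (binom_coef (2 * INR m + 1)) 0 PI r)]; trivial.
  - intros k. simpl. rewrite Rmult_assoc. f_equal. apply is_RInt_unique.
    rewrite Rmult_comm.
    apply (is_RInt_ext (fun t => scal (r ^ k) (legendre_weight m n t * cos t ^ k))).
    + intros t _. rewrite Rpow_mult_distr. unfold scal; simpl; unfold mult; simpl. ring.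
    + apply @is_RInt_scal, is_RInt_legendre_moment.
  - apply Rlt_le, PI_RGT_0.
  - intros t _. apply continuous_legendre_weight, continuous_id.
  - intros t _. continuity_arith.
  - rewrite CV_radius_binom; simpl; lra.
Qed.

Lemma legendre_integral_neumann (m n : nat) (r : R) : (m <= n)%nat -> 0 <= r < 1 ->
  legendre_integral m n (fun x => / (1 - r * x) ^ (2 * m + 1)) =
  INR (Factorial.fact (n + m)) ^ 2 * sqrt PI
  / (INR (Factorial.fact (2 * m)) * INR (Factorial.fact (n - m)) * 2 ^ n)
  * r ^ (n - m) * PSeries (Q_coef m n) (r ^ 2).
Proof.
  intros Hmn Hr. rewrite legendre_integral_neumann_series by trivial.
  destruct (Nat.le_exists_sub m n Hmn) as [d [-> _]]. rewrite (Nat.add_comm d m).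
  replace (m + d - m)%nat with d by lia.
  set (C := binom_coef (2 * INR m + 1) d * legendre_moment m (m + d) d * gamma_half (m + d + 1)).
  assert (Hex : ex_pseries (PS_scal C (Q_coef m (m + d))) (r ^ 2)).
  { apply ex_pseries_scal; [apply Rmult_comm|]. apply (ex_pseries_inside _ _ 1);
      [apply CV_radius_Q|]. rewrite Rabs_pos_eq; nra. }
  rewrite (PSeries_support _ d).
  - rewrite (PSeries_ext _ (PS_scal C (Q_coef m (m + d)))) by (intros; apply binom_moment_Q_coef).
    rewrite PSeries_scal.
    pose proof (legendre_moment_leading m (m + d) ltac:(lia)) as Hmoment.
    replace (m + d - m)%nat with d in Hmoment by lia.
    unfold C. rewrite Hmoment. replace (2 * INR m) with (INR (2 * m)) by now rewrite mult_INR.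
    rewrite binom_coef_INR_S. replace (2 * m + d)%nat with (m + d + m)%nat by lia.
    pose proof (gamma_half_pos (m + d + 1)).
    field. repeat split; try apply INR_fact_neq_0; try lra. apply pow_nonzero; lra.
  - intros j Hj. rewrite legendre_moment_eq_0 by trivial. ring.
  - apply (ex_pseries_ext (PS_scal C (Q_coef m (m + d)))); trivial.
    intros k. symmetry. apply binom_moment_Q_coef.
Qed.

(** * The integral for distinct radii *)

Lemma legP_legendre_deriv (m n : nat) (z : R) : 1 < z ->
  legP m n z = sqrt (z ^ 2 - 1) ^ m * legendre_deriv n m z.
Proof.
  intros Hz. unfold legP, hyp2F1reg.
  rewrite (Series_incr_n_aux _ m).
  2:{ intros k Hk. unfold rgamma_int.
    replace (1 - Z.of_nat m + Z.of_nat k <=? 0)%Z with true by (symmetry; apply Z.leb_le; lia).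
    unfold Rdiv. ring. }
  rewrite (Series_finite _ n) by (intros k Hk; rewrite poch_opp_INR_eq_0 by lia; unfold Rdiv; ring).
  rewrite (sum_eq _ (fun k => (z - 1) ^ k / INR (Factorial.fact k) * legendre_deriv n (m + k) 1
     * (z - 1) ^ m)).
  2:{ intros k _. unfold rgamma_int.
    replace (1 - Z.of_nat m + Z.of_nat (m + k) <=? 0)%Z with false
      by (symmetry; apply Z.leb_gt; lia).
    replace (Z.to_nat (1 - Z.of_nat m + Z.of_nat (m + k) - 1)) with k by lia.
    rewrite legendre_deriv_at_1_poch.
    replace ((1 - z) / 2) with (- / 2 * (z - 1)) by field.
    rewrite Rpow_mult_distr, (pow_add (z - 1)). field. split; apply INR_fact_neq_0. }
  rewrite <- scal_sum, <- legendre_deriv_taylor, <- Rmult_assoc, <- Rpow_mult_distr by trivial.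
  do 2 f_equal. rewrite <- (sqrt_pow2 (z - 1)) at 2 by lra. rewrite <- sqrt_mult_alt.
  - f_equal. field. lra.
  - apply Rlt_le, Rdiv_lt_0_compat; lra.
Qed.

Lemma legQ_PSeries (m n : nat) (z : R) : legQ m n z =
  (-1) ^ m * sqrt PI * INR (Factorial.fact (n + m)) * sqrt (z ^ 2 - 1) ^ m
  / (2 ^ (n + 1) * z ^ (n + m + 1)) * PSeries (Q_coef m n) (/ z ^ 2).
Proof. reflexivity. Qed.

Lemma legendre_integral_legQ (m n : nat) (z : R) : (m <= n)%nat -> 1 < z ->
  legendre_integral m n (fun x => / (z - x) ^ (2 * m + 1)) =
  2 * (-1) ^ m * INR (Factorial.fact (n + m))
  / (INR (Factorial.fact (2 * m)) * INR (Factorial.fact (n - m)))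
  * (legQ m n z / sqrt (z ^ 2 - 1) ^ m).
Proof.
  intros Hmn Hz. set (r := / z).
  assert (Hr : 0 <= r < 1).
  { unfold r. split; [apply Rlt_le, Rinv_0_lt_compat; lra|].
    rewrite <- Rinv_1. apply Rinv_lt_contravar; lra. }
  transitivity (legendre_integral m n (fun x => / (1 - r * x) ^ (2 * m + 1)) * r ^ (2 * m + 1)).
  { assert (Hne : forall t, 1 - r * cos t <> 0) by (intros t; pose proof (COS_bound t); nra).
    rewrite <- legendre_integral_scal_r
      by (intros t; continuity_arith; apply pow_nonzero, Hne).
    apply legendre_integral_ext. intros t. unfold r.
    rewrite pow_inv, <- Rinv_mult, <- Rpow_mult_distr.
    do 2 f_equal. field. lra. }
  rewrite legendre_integral_neumann, legQ_PSeries by trivial. unfold r. rewrite !pow_inv.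
  pose proof (pow_opp_1_sqr m) as Hsign.
  assert (Hz' : z ^ (n + m + 1) = z ^ (n - m) * z ^ (2 * m + 1))
    by (rewrite <- pow_add; f_equal; lia).
  assert (sqrt_neq_0 : sqrt (z ^ 2 - 1) <> 0) by (apply Rgt_not_eq, sqrt_lt_R0; nra).
  rewrite Hz', (pow_add 2 n 1), pow_1.
  pose proof (pow_nonzero 2 n ltac:(lra)).
  pose proof (pow_nonzero z (n - m) ltac:(lra)). pose proof (pow_nonzero z (2 * m + 1) ltac:(lra)).
  pose proof (pow_nonzero _ m sqrt_neq_0).
  set (q := PSeries _ _). set (sg := (-1) ^ m) in *.
  transitivity (sg * sg * (INR (Factorial.fact (n + m)) ^ 2 * sqrt PI
    / (INR (Factorial.fact (2 * m)) * INR (Factorial.fact (n - m)) * 2 ^ n)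
    * / z ^ (n - m) * q * / z ^ (2 * m + 1))); [rewrite Hsign; ring|].
  field. repeat split; trivial; apply INR_fact_neq_0.
Qed.

Lemma chi_num_minus (s s' t t' : R) :
  chi_num (cos t) (cos t') (cosh s) (cosh s') - 2 * sinh s * sinh s' * sin t * sin t' =
  (cosh (s + s') - cos (t + t')) * (cosh (s - s') - cos (t - t')).
Proof.
  rewrite cosh_plus, cosh_minus, cos_plus, cos_minus.
  transitivity ((cosh s * cosh s' - cos t * cos t') ^ 2
     - sinh s ^ 2 * sinh s' ^ 2 - sin t ^ 2 * sin t' ^ 2
     - 2 * sinh s * sinh s' * sin t * sin t'); [|ring].
  replace (sinh s ^ 2) with (cosh s ^ 2 - 1) by (rewrite cosh_pow2; ring).
  replace (sinh s' ^ 2) with (cosh s' ^ 2 - 1) by (rewrite cosh_pow2; ring).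
  rewrite !sin_pow2. unfold chi_num. ring.
Qed.

Lemma chi_num_plus (s s' t t' : R) :
  chi_num (cos t) (cos t') (cosh s) (cosh s') + 2 * sinh s * sinh s' * sin t * sin t' =
  (cosh (s + s') - cos (t - t')) * (cosh (s - s') - cos (t + t')).
Proof.
  pose proof (chi_num_minus s s' t (- t')) as Hminus.
  rewrite cos_neg, sin_neg in Hminus.
  replace (t - - t') with (t + t') in Hminus by ring.
  change (t + - t') with (t - t') in Hminus. rewrite <- Hminus. ring.
Qed.

Lemma chi_den2_trig (s s' t t' : R) : chi_den2 (cos t) (cos t') (cosh s) (cosh s') =
  (2 * sinh s * sinh s' * sin t * sin t') ^ 2.
Proof.
  unfold chi_den2. rewrite !cosh_pow2.
  transitivity (4 * sinh s ^ 2 * sinh s' ^ 2 * sin t ^ 2 * sin t' ^ 2); [|ring].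
  rewrite !sin_pow2. ring.
Qed.

Lemma kernel_regular_trig (s s' t t' : R) : 1 < cosh (s + s') ->
  cos (t + t') < cosh (s - s') -> cos (t - t') < cosh (s - s') ->
  kernel_regular (cos t) (cos t') (cosh s) (cosh s').
Proof.
  intros Hsum Hplus Hminus. pose proof (COS_bound (t + t')). pose proof (COS_bound (t - t')).
  assert (Hm : 0 < (cosh (s + s') - cos (t + t')) * (cosh (s - s') - cos (t - t')))
    by (apply Rmult_lt_0_compat; lra).
  assert (Hp : 0 < (cosh (s + s') - cos (t - t')) * (cosh (s - s') - cos (t + t')))
    by (apply Rmult_lt_0_compat; lra).
  rewrite <- chi_num_minus in Hm. rewrite <- chi_num_plus in Hp. split; [lra|].
  rewrite chi_den2_trig, Rabs_pos_eq by apply pow2_ge_0. nra.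
Qed.

Lemma kernel_regular_distinct_radii (s s' t t' : R) : s + s' <> 0 -> s - s' <> 0 ->
  kernel_regular (cos t) (cos t') (cosh s) (cosh s').
Proof.
  intros Hplus Hminus. apply cosh_gt_1 in Hplus. apply cosh_gt_1 in Hminus.
  pose proof (COS_bound (t + t')). pose proof (COS_bound (t - t')).
  apply kernel_regular_trig; lra.
Qed.

Lemma kernel_integral_cosh (m n : nat) (s s' t' : R) : 0 <= s' < s ->
  kernel_integral m n (cosh s') (cos t') (cosh s) * legendre_deriv n m 1 =
  legendre_deriv n m (cosh s') * kernel_integral m n 1 (cos t') (cosh s).
Proof.
  intros Hs. apply (kernel_integral_separate m n (-1) s 0 cosh sinh); trivial.
  - apply cosh_0.
  - intros z. apply is_derive_Reals, derivable_pt_lim_cosh.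
  - intros z. replace (- (-1) * cosh z) with (cosh z) by ring.
    apply is_derive_Reals, derivable_pt_lim_sinh.
  - intros z. rewrite cosh_pow2. ring.
  - intros z Hz. pose proof (sinh_pos z); lra.
  - intros z Hz t. apply Rabs_def2 in Hz.
    apply kernel_regular_rot, kernel_regular_distinct_radii; lra.
  - intros z Hz. pose proof (sinh_pos z ltac:(lra)). pose proof (cosh_ge_1 z).
    pose proof (pos_INR m). unfold polar_drift.
    assert (0 < - (-1) * cosh z / sinh z) by (apply Rdiv_lt_0_compat; lra). nra.
Qed.

Lemma kernel_integral_cos (m n : nat) (s t' : R) : 0 < s -> 0 < t' < PI ->
  kernel_integral m n (cos t') 1 (cosh s) * legendre_deriv n m 1 =
  legendre_deriv n m (cos t') * kernel_integral m n 1 1 (cosh s).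
Proof.
  intros Hs Ht. set (L := (t' + PI) / 2).
  apply (kernel_integral_separate m n 1 L ((2 * INR m + 1) * - (cos L / sin L))
    cos (fun t => - sin t)); trivial.
  - apply cos_0.
  - intros z. apply is_derive_cos.
  - intros z. auto_derive; trivial. ring.
  - intros z. pose proof (sin_pow2 z). lra.
  - unfold L. intros z Hz. pose proof (sin_gt_0 z). lra.
  - intros z _ t. rewrite <- cosh_0. apply kernel_regular_distinct_radii; lra.
  - intros z Hz. assert (0 < sin z) by (apply sin_gt_0; unfold L in *; lra).
    pose proof (cotan_decreasing z L Hz ltac:(unfold L; lra)). pose proof (pos_INR m).
    unfold polar_drift. replace (- (1) * cos z / - sin z) with (cos z / sin z) by (field; lra).
    nra.
  - unfold L; lra.
Qed.

Lemma kernel_at_1_1 (m : nat) (x a : R) : x < a ->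
  kernel m 1 x 1 a = / (a - x) ^ (2 * m + 1) * / INR (Factorial.fact m).
Proof.
  intros Hx. unfold kernel, hom_kernel, kernel_mode, neg_half_pow, PSeries_deriv.
  replace (chi_den2 1 x 1 a) with 0 by (unfold chi_den2; ring).
  replace (chi_num 1 x 1 a) with ((a - x) ^ 2) by (unfold chi_num; ring).
  unfold Rdiv. rewrite Rmult_0_l, PSeries_0, sqrt_pow2, Nat.add_0_r, <- pow_mult, pow_add by lra.
  cbn [Nat.iter nat_rect]. unfold Qhalf_coef, hyp2F1_coef.
  rewrite Nat.add_0_r. simpl (Factorial.fact 0). rewrite pow_1, Rmult_comm.
  f_equal. simpl. field. apply INR_fact_neq_0.
Qed.

Lemma kernel_integral_swap13 (m n : nat) (y b a : R) :
  kernel_integral m n y b a = kernel_integral m n b y a.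
Proof. apply legendre_integral_ext. intros t. apply kernel_swap13. Qed.

Lemma kernel_integral_1_1 (m n : nat) (s : R) : (m <= n)%nat -> 0 < s ->
  kernel_integral m n 1 1 (cosh s) =
  2 * (-1) ^ m * INR (Factorial.fact (n + m))
    / (INR (Factorial.fact (2 * m)) * INR (Factorial.fact (n - m)))
  * (legQ m n (cosh s) / sinh s ^ m) * / INR (Factorial.fact m).
Proof.
  intros Hmn Hs. assert (1 < cosh s) by (apply cosh_gt_1; lra).
  unfold kernel_integral.
  rewrite (legendre_integral_ext m n _ (fun x =>
    / (cosh s - x) ^ (2 * m + 1) * / INR (Factorial.fact m)))
    by (intros t; pose proof (COS_bound t); apply kernel_at_1_1; lra).
  rewrite legendre_integral_scal_r, legendre_integral_legQ, sqrt_cosh_pow2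
    by (trivial; try lra; intros t; pose proof (COS_bound t);
        continuity_arith; apply pow_nonzero; lra).
  trivial.
Qed.

Lemma kernel_integral_closed_form (m n : nat) (s s' t' : R) :
  (m <= n)%nat -> 0 <= s' < s -> 0 < t' < PI ->
  kernel_integral m n (cosh s') (cos t') (cosh s) =
  2 * (-1) ^ m * (sqrt PI / gamma_half m)
  * (INR (Factorial.fact (n - m)) / INR (Factorial.fact (n + m)))
  * legendre_deriv n m (cosh s') * legendre_deriv n m (cos t') * (legQ m n (cosh s) / sinh s ^ m).
Proof.
  intros Hmn Hs Ht. assert (1 < cosh s) by (apply cosh_gt_1; lra).
  pose proof (kernel_integral_cosh m n s s' t' Hs) as Hcosh.
  pose proof (kernel_integral_cos m n s t' ltac:(lra) Ht) as Hcos.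
  rewrite (kernel_integral_swap13 m n 1) in Hcosh.
  rewrite kernel_integral_1_1 in Hcos by (trivial; lra).
  rewrite legendre_deriv_at_1 in Hcosh, Hcos by trivial.
  set (J := kernel_integral m n (cosh s') (cos t') (cosh s)) in *.
  set (J1 := kernel_integral m n (cos t') 1 (cosh s)) in *.
  pose proof (INR_fact_neq_0 (n + m)). pose proof (INR_fact_neq_0 (n - m)).
  pose proof (INR_fact_neq_0 (2 * m)). pose proof (INR_fact_neq_0 m).
  pose proof (pow_nonzero 2 m ltac:(lra)).
  pose proof (sqrt_lt_R0 PI PI_RGT_0).
  pose proof (pow_lt _ m (sinh_pos s ltac:(lra))).
  rewrite gamma_half_fact. replace (4 ^ m) with (2 ^ m * 2 ^ m)
    by (rewrite <- Rpow_mult_distr; f_equal; ring).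
  set (k := INR (Factorial.fact (n + m)) / _) in *.
  assert (k <> 0)
    by (unfold k, Rdiv; repeat (apply Rmult_integral_contrapositive_currified
          || apply Rinv_neq_0_compat); trivial).
  apply (Rmult_eq_reg_r (k * k)); [|now apply Rmult_integral_contrapositive_currified].
  rewrite <- Rmult_assoc, Hcosh, Rmult_assoc, Hcos. unfold k. field. repeat split; trivial; lra.
Qed.

Lemma ferrersP_cos (m n : nat) (t : R) : 0 <= t <= PI ->
  ferrersP m n (cos t) = (-1) ^ m * sin t ^ m * legendre_deriv n m (cos t).
Proof.
  intros Ht. unfold ferrersP. rewrite Derive_n_legendre, <- sin_pow2, sqrt_pow2; trivial.
  now apply sin_ge_0.
Qed.

Lemma legQhalf_PSeries (m : nat) (z : R) : legQhalf m z =
  sqrt PI * gamma_half m / (2 ^ m * sqrt 2 * (z ^ m * sqrt z))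
  * PSeries_deriv (Qhalf_coef m) 0 (/ z ^ 2).
Proof. reflexivity. Qed.

Lemma legQhalf_hom_kernel (m : nat) (s d : R) : 0 < s -> 0 < d -> legQhalf m (s / (2 * d)) =
  sqrt PI * gamma_half m * (d ^ m * sqrt d) * hom_kernel m s ((2 * d) ^ 2).
Proof.
  intros Hs Hd. rewrite legQhalf_PSeries. unfold hom_kernel, kernel_mode, neg_half_pow.
  replace (/ (s / (2 * d)) ^ 2) with ((2 * d) ^ 2 / s ^ 2) by (field; lra).
  rewrite Nat.add_0_r, sqrt_div_alt, sqrt_mult by lra.
  unfold Rdiv at 2. rewrite (Rpow_mult_distr s), pow_inv, (Rpow_mult_distr 2).
  pose proof (sqrt_lt_R0 s Hs). pose proof (sqrt_lt_R0 d Hd). pose proof (sqrt_lt_R0 2 ltac:(lra)).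
  pose proof (pow_lt s m Hs). pose proof (pow_lt d m Hd). pose proof (pow_lt 2 m ltac:(lra)).
  field. repeat split; lra.
Qed.

Definition kernel_integrand_factor (m : nat) (E : R) : R :=
  (-1) ^ m * sqrt PI * gamma_half m * (E ^ m * sqrt E).

Definition kernel_integrand (m n : nat) (s s' t' t : R) : R :=
  kernel_integrand_factor m (sinh s * sinh s' * sin t')
  * (legendre_weight m n t * kernel m (cosh s') (cos t) (cos t') (cosh s)).

Lemma kernel_integrand_legQhalf (m n : nat) (s s' t' t : R) :
  0 < s -> 0 < s' -> 0 < t' < PI -> 0 <= t <= PI ->
  kernel_integrand m n s s' t' t =
  legQhalf m (chi s s' t t') * ferrersP m n (cos t) * sqrt (sin t).
Proof.
  intros Hs Hs' Ht' Ht. rewrite ferrersP_cos by trivial.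
  unfold kernel_integrand, kernel_integrand_factor, legendre_weight.
  destruct (Req_dec (sin t) 0) as [sin_t_0|sin_t_neq_0].
  { rewrite sin_t_0, sqrt_0, (pow_i (2 * m + 1)) by lia. ring. }
  assert (Hsin : 0 < sin t) by (pose proof (sin_ge_0 t (proj1 Ht) (proj2 Ht)); lra).
  set (E := sinh s * sinh s' * sin t').
  assert (HE : 0 < E)
    by (apply Rmult_lt_0_compat; [apply Rmult_lt_0_compat; now apply sinh_pos|now apply sin_gt_0]).
  rewrite kernel_rot. unfold kernel. rewrite chi_den2_trig.
  set (q := chi_num (cos t) (cos t') (cosh s) (cosh s')).
  assert (Hq : 0 < q).
  { assert (0 <= q - 2 * sinh s * sinh s' * sin t * sin t').
    { unfold q. rewrite chi_num_minus.
      pose proof (cosh_ge_1 (s + s')). pose proof (cosh_ge_1 (s - s')).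
      pose proof (COS_bound (t + t')). pose proof (COS_bound (t - t')).
      apply Rmult_le_pos; lra. }
    pose proof (Rmult_lt_0_compat _ _ HE Hsin). unfold E in *. lra. }
  assert (Hchi : chi s s' t t' = q / (2 * (E * sin t))).
  { unfold chi, q, chi_num, E. rewrite (sin_pow2 t), (sin_pow2 t'). f_equal; ring. }
  rewrite Hchi, legQhalf_hom_kernel by (trivial; now apply Rmult_lt_0_compat).
  replace (2 * sinh s * sinh s' * sin t * sin t') with (2 * (E * sin t)) by (unfold E; ring).
  rewrite sqrt_mult, (Rpow_mult_distr E (sin t) m) by lra.
  replace (2 * m + 1)%nat with (m + m + 1)%nat by lia. rewrite !pow_add.
  replace (sin t ^ 1) with (sqrt (sin t) * sqrt (sin t)) by (rewrite sqrt_sqrt; lra). ring.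
Qed.

Definition closed_form (m n : nat) (s s' t' : R) : R :=
  2 * PI * (-1) ^ m * INR (Factorial.fact (n - m)) / INR (Factorial.fact (n + m))
    * sqrt (sinh s * sinh s' * sin t') * ferrersP m n (cos t')
    * legP m n (cosh s') * legQ m n (cosh s).

Lemma continuous_kernel_integrand (m n : nat) (s s' t' t : R) : 0 < s' < s ->
  continuous (kernel_integrand m n s s' t') t.
Proof.
  intros Hs. unfold kernel_integrand. set (C := kernel_integrand_factor _ _).
  apply (continuous_mult (fun _ => C)); [apply continuous_const|].
  apply (continuous_legendre_weight_mult m n
    (fun t => kernel m (cosh s') (cos t) (cos t') (cosh s))).
  apply continuous_kernel; [continuity_arith ..|].
  apply kernel_regular_rot, kernel_regular_distinct_radii; lra.
Qed.

Lemma is_RInt_kernel_integrand (m n : nat) (s s' t' : R) :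
  (m <= n)%nat -> 0 < s' < s -> 0 < t' < PI ->
  is_RInt (kernel_integrand m n s s' t') 0 PI (closed_form m n s s' t').
Proof.
  intros Hmn Hs Ht. set (E := sinh s * sinh s' * sin t').
  replace (closed_form m n s s' t') with (kernel_integrand_factor m E
    * kernel_integral m n (cosh s') (cos t') (cosh s)).
  - apply @is_RInt_scal.
    apply (legendre_integral_correct m n (fun x => kernel m (cosh s') x (cos t') (cosh s))).
    intros t. apply continuous_kernel; [continuity_arith ..|].
    apply kernel_regular_rot, kernel_regular_distinct_radii; lra.
  - rewrite kernel_integral_closed_form by (trivial; lra). unfold closed_form.
    rewrite ferrersP_cos, legP_legendre_deriv, sqrt_cosh_pow2 by (try apply cosh_gt_1; lra).
    assert (HPI : PI = sqrt PI * sqrt PI) by (symmetry; apply sqrt_sqrt, Rlt_le, PI_RGT_0).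
    unfold kernel_integrand_factor. rewrite HPI at 3. fold E. unfold E at 1.
    rewrite !Rpow_mult_distr.
    pose proof (pow_lt _ m (sinh_pos s ltac:(lra))). pose proof (gamma_half_pos m).
    field. repeat split; try apply INR_fact_neq_0; lra.
Qed.

(** * The singularity at equal radii *)

Lemma hom_kernel_bound (m : nat) : exists C, 0 < C /\ forall s p, 0 < s -> 0 <= p < s ^ 2 ->
  0 <= hom_kernel m s p <= C * neg_half_pow m s * Rpower (1 - p / s ^ 2) (- / 4).
Proof.
  pose proof (pos_INR m).
  destruct (hyp2F1_singularity ((INR m - /2) / 2 + 1) ((INR m + /2) / 2) (INR m + 1)
    (fun k => / INR (Factorial.fact (m + k))) (/ 4) ltac:(lra) ltac:(lra) ltac:(lra)
    (inv_fact_S m) (fun k => inv_fact_pos (m + k)) ltac:(lra) ltac:(lra)) as [C [HC HG]].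
  exists C. split; trivial. intros s p Hs Hp.
  assert (Hu : 0 <= p / s ^ 2 < 1).
  { split; [apply Rdiv_le_0_compat; nra|].
    apply (Rmult_lt_reg_r (s ^ 2)); [nra|]. field_simplify; [lra|lra]. }
  specialize (HG _ Hu). pose proof (neg_half_pow_pos m s Hs).
  unfold hom_kernel, kernel_mode. rewrite Nat.add_0_r.
  unfold PSeries_deriv. cbn [Nat.iter nat_rect]. unfold Qhalf_coef. nra.
Qed.

(* [1 - d^2 / s^2 = (s - d) (s + d) / s^2] is at least a multiple of [x^2]. *)
Lemma hom_kernel_singular_bound (m : nat) (c0 c1 smax : R) : 0 < c0 -> 0 < c1 -> 0 < smax ->
  exists C, 0 <= C /\ forall s d x, x <> 0 -> 0 <= d -> s <= smax -> c0 <= s + d ->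
    c1 * x ^ 2 <= s - d -> Rabs (hom_kernel m s (d ^ 2)) <= C * / sqrt (Rabs x).
Proof.
  intros Hc0 Hc1 Hsmax. destruct (hom_kernel_bound m) as [C [HC Hbound]].
  set (k := c0 * c1 / smax ^ 2).
  assert (Hk : 0 < k) by (apply Rdiv_lt_0_compat; [nra|now apply pow_lt]).
  pose proof (neg_half_pow_pos m (c0 / 2) ltac:(lra)) as Hh0.
  pose proof (exp_pos (- / 4 * ln k) : 0 < Rpower k (- / 4)) as Hkq.
  exists (C * neg_half_pow m (c0 / 2) * Rpower k (- / 4)). split.
  { apply Rlt_le, Rmult_lt_0_compat; trivial. now apply Rmult_lt_0_compat. }
  intros s d x Hx Hd Hs Hplus Hminus.
  assert (Hx2 : 0 < x ^ 2) by now apply pow2_gt_0.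
  assert (Hcx2 : 0 < c1 * x ^ 2) by now apply Rmult_lt_0_compat. assert (Hs0 : c0 / 2 <= s) by lra.
  assert (Hgap : k * x ^ 2 <= 1 - d ^ 2 / s ^ 2).
  { replace (1 - d ^ 2 / s ^ 2) with ((s + d) * (s - d) / s ^ 2) by (field; lra).
    replace (k * x ^ 2) with (c0 * (c1 * x ^ 2) / smax ^ 2) by (unfold k; field; lra).
    apply Rmult_le_compat; [nra|apply Rlt_le, Rinv_0_lt_compat, pow_lt; lra| |].
    - apply Rmult_le_compat; nra.
    - apply Rinv_le_contravar; [apply pow_lt; lra|apply pow_incr; lra]. }
  destruct (Hbound s (d ^ 2) ltac:(lra) ltac:(split; nra)) as [Hpos Hle].
  rewrite Rabs_pos_eq by trivial. apply (Rle_trans _ _ _ Hle).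
  rewrite <- (Rpower_pow2_quarter x Hx), (Rmult_assoc (C * _)), Rpower_mult_distr by trivial.
  apply Rmult_le_compat; [|apply Rlt_le, exp_pos| |].
  - apply Rlt_le, Rmult_lt_0_compat; trivial. apply neg_half_pow_pos. lra.
  - apply Rmult_le_compat_l; [lra|]. apply neg_half_pow_antitone. lra.
  - rewrite !Rpower_Ropp. apply Rinv_le_contravar; [apply exp_pos|].
    apply Rle_Rpower_l; [lra|]. split; trivial. now apply Rmult_lt_0_compat.
Qed.

Lemma chi_num_le (x y a b : R) : -1 <= x <= 1 -> -1 <= y <= 1 -> 0 <= b <= a ->
  chi_num x y a b <= 4 * a ^ 2.
Proof.
  intros Hx Hy Hab.
  assert (Hxy : 0 <= 1 + x * y) by nra.
  assert (0 <= 2 * (1 + x * y) * (a * b)) by (apply Rmult_le_pos; nra).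
  assert (x ^ 2 <= 1 /\ y ^ 2 <= 1) by nra. assert (b ^ 2 <= a ^ 2 /\ a * b <= a ^ 2) by nra.
  unfold chi_num. nra.
Qed.

Section EqualRadii.
Variables (m n : nat) (s t' : R).
Hypotheses (Hs : 0 < s) (Ht' : 0 < t' < PI).

Lemma kernel_regular_distinct_angles (s' t : R) : 0 < s' -> 0 <= t <= PI -> t <> t' ->
  kernel_regular (cosh s') (cos t) (cos t') (cosh s).
Proof.
  intros Hs' Ht Hne. apply kernel_regular_rot. pose proof (cosh_ge_1 (s - s')).
  pose proof (cos_plus_le_abs t t' Ht ltac:(lra)). pose proof (abs_cos_lt_1 t' Ht').
  pose proof (one_minus_cos_ge (t - t') ltac:(apply Rabs_le; lra)).
  assert (0 < (t - t') ^ 2) by (apply pow2_gt_0; lra).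
  apply kernel_regular_trig; [apply cosh_gt_1| |]; lra.
Qed.

Lemma kernel_singular_bound : exists C, 0 <= C /\
  forall s' t, 0 < s' <= s -> 0 <= t <= PI -> t <> t' ->
  Rabs (kernel m (cosh s') (cos t) (cos t') (cosh s)) <= C * / sqrt (Rabs (t - t')).
Proof.
  assert (Hcosh : 1 < cosh s) by (apply cosh_gt_1; lra).
  pose proof (abs_cos_lt_1 t' Ht') as Habs.
  destruct (hom_kernel_singular_bound m ((cosh s - 1) * (1 - Rabs (cos t'))) ((cosh s - 1) / 18)
    (4 * cosh s ^ 2)) as [C [HC Hbound]]; [nra|nra|nra|].
  exists C. split; trivial. intros s' t Hs' Ht Hne.
  rewrite kernel_rot. unfold kernel. rewrite chi_den2_trig.
  pose proof (cosh_ge_1 (s - s')). pose proof (COS_bound (t + t')). pose proof (COS_bound (t - t')).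
  assert (Hcosh_plus : cosh s <= cosh (s + s')) by (apply cosh_le; lra).
  apply Hbound.
  - lra.
  - pose proof (sinh_pos s Hs). pose proof (sinh_pos s' ltac:(lra)).
    pose proof (sin_ge_0 t ltac:(lra) ltac:(lra)). pose proof (sin_ge_0 t' ltac:(lra) ltac:(lra)).
    repeat (apply Rmult_le_pos; [|lra]). lra.
  - pose proof (cosh_ge_1 s'). pose proof (cosh_le s' s ltac:(lra)).
    apply chi_num_le; [apply COS_bound..|lra].
  - rewrite chi_num_plus. pose proof (cos_plus_le_abs t t' Ht ltac:(lra)).
    apply Rmult_le_compat; lra.
  - rewrite chi_num_minus. pose proof (one_minus_cos_ge (t - t') ltac:(apply Rabs_le; lra)).
    pose proof (pow2_ge_0 (t - t')).
    replace ((cosh s - 1) / 18 * (t - t') ^ 2) with ((cosh s - 1) * ((t - t') ^ 2 / 18)) by field.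
    apply Rmult_le_compat; lra.
Qed.

Let continuous_factor s' :
  continuous (fun s' => kernel_integrand_factor m (sinh s * sinh s' * sin t')) s'.
Proof. unfold kernel_integrand_factor. continuity_arith; apply continuous_sinh. Qed.

Lemma kernel_integrand_dominated : exists C, 0 <= C /\
  forall s' t, s / 2 <= s' <= s -> 0 <= t <= PI -> t <> t' ->
  Rabs (kernel_integrand m n s s' t' t) <= C * / sqrt (Rabs (t - t')).
Proof.
  pose proof PI_RGT_0.
  destruct kernel_singular_bound as [C [HC Hkernel]].
  destruct (continuous_segment_bounded _ (s / 2) s ltac:(lra) (fun s' _ => continuous_factor s'))
    as [K HK].
  destruct (continuous_segment_bounded (legendre_weight m n) 0 PI ltac:(lra)) as [W HW].
  { intros t _. apply continuous_legendre_weight, continuous_id. }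
  assert (0 <= K) by (eapply Rle_trans; [apply Rabs_pos|apply (HK s); lra]).
  assert (0 <= W) by (eapply Rle_trans; [apply Rabs_pos|apply (HW 0); lra]).
  exists (K * (W * C)). split; [repeat apply Rmult_le_pos; trivial|].
  intros s' t Hs' Ht Hne. unfold kernel_integrand.
  rewrite Rabs_mult, (Rmult_assoc K), (Rmult_assoc W).
  apply Rmult_le_compat; [apply Rabs_pos..|now apply HK|]. rewrite Rabs_mult.
  apply Rmult_le_compat; [apply Rabs_pos..|now apply HW|].
  apply Hkernel; trivial. lra.
Qed.

Lemma continuous_kernel_integrand_radius (t : R) : 0 <= t <= PI -> t <> t' ->
  continuous (fun s' => kernel_integrand m n s s' t' t) s.
Proof.
  intros Ht Hne. apply (continuous_mult
    (fun s' => kernel_integrand_factor m (sinh s * sinh s' * sin t'))); [apply continuous_factor|].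
  apply (continuous_mult (fun _ => legendre_weight m n t)); [apply continuous_const|].
  apply continuous_kernel; [apply continuous_cosh|apply continuous_const ..|].
  now apply kernel_regular_distinct_angles.
Qed.

Lemma continuous_closed_form_radius : continuous (fun s' => closed_form m n s s' t') s.
Proof.
  apply (continuous_ext_loc _ (fun s' =>
    2 * PI * (-1) ^ m * INR (Factorial.fact (n - m)) / INR (Factorial.fact (n + m))
    * sqrt (sinh s * sinh s' * sin t') * ferrersP m n (cos t')
    * (sinh s' ^ m * legendre_deriv n m (cosh s')) * legQ m n (cosh s))).
  - apply filter_imp with (2 := open_gt 0 s Hs). intros s' Hs'. unfold closed_form.
    rewrite legP_legendre_deriv, sqrt_cosh_pow2 by (try apply cosh_gt_1; lra). reflexivity.
  - unfold Rdiv. continuity_arith; try apply continuous_sinh.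
    apply continuous_legendre_deriv, continuous_cosh.
Qed.
End EqualRadii.

(* A smooth approximation of [sign x * sqrt |x|], whose derivative approximates
   [1 / (2 sqrt |x|)]. *)
Definition sqrt_reg (e x : R) : R := x / sqrt (sqrt (x ^ 2 + e)).

Definition sqrt_reg_derive (e x : R) : R :=
  (x ^ 2 / 2 + e) / ((x ^ 2 + e) * sqrt (sqrt (x ^ 2 + e))).

Lemma sqrt_sqrt_pow2 (x : R) : sqrt (sqrt (x ^ 2)) = sqrt (Rabs x).
Proof. now rewrite <- Rsqr_pow2, sqrt_Rsqr_abs. Qed.

Lemma is_derive_sqrt_reg (e x : R) : 0 < e ->
  is_derive (sqrt_reg e) x (sqrt_reg_derive e x).
Proof.
  intros He. assert (Harg : 0 < x ^ 2 + e) by (pose proof (pow2_ge_0 x); lra).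
  pose proof (sqrt_lt_R0 _ Harg) as Hr2. pose proof (sqrt_lt_R0 _ Hr2) as Hr.
  pose proof (sqrt_sqrt _ (Rlt_le _ _ Harg)) as Er2.
  pose proof (sqrt_sqrt _ (Rlt_le _ _ Hr2)) as Er.
  unfold sqrt_reg, sqrt_reg_derive. auto_derive;
    replace (x * (x * 1) + e) with (x ^ 2 + e) by ring; [repeat split; trivial; lra|].
  set (r := sqrt (sqrt (x ^ 2 + e))) in *. set (r2 := sqrt (x ^ 2 + e)) in *.
  assert (Ee : e = r2 * r2 - x ^ 2) by lra. clearbody r r2. rewrite Ee, <- Er. field. nra.
Qed.

Lemma sqrt_reg_derive_pos (e x : R) : 0 < e -> 0 < sqrt_reg_derive e x.
Proof.
  intros He. pose proof (pow2_ge_0 x).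
  apply Rdiv_lt_0_compat; [lra|]. apply Rmult_lt_0_compat; [lra|].
  apply sqrt_lt_R0, sqrt_lt_R0. lra.
Qed.

Lemma continuous_sqrt_reg_derive (e x : R) : 0 < x ^ 2 + e ->
  continuous (fun p : R * R => sqrt_reg_derive (fst p) (snd p)) (e, x).
Proof.
  intros Harg. unfold sqrt_reg_derive. continuity_arith; [lra|].
  pose proof (sqrt_lt_R0 _ (sqrt_lt_R0 _ Harg)). simpl fst. simpl snd. nra.
Qed.

Lemma Rabs_sqrt_reg_le (e x : R) : 0 < e -> Rabs (sqrt_reg e x) <= sqrt (Rabs x).
Proof.
  intros He. pose proof (pow2_ge_0 x). unfold sqrt_reg.
  assert (Hr : 0 < sqrt (sqrt (x ^ 2 + e))) by (apply sqrt_lt_R0, sqrt_lt_R0; lra).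
  rewrite Rabs_div, (Rabs_pos_eq (sqrt _)) by lra.
  apply Rle_div_l; trivial. rewrite <- (sqrt_sqrt (Rabs x)) at 1 by apply Rabs_pos.
  apply Rmult_le_compat_l; [apply sqrt_pos|]. rewrite <- sqrt_sqrt_pow2.
  apply sqrt_le_1_alt, sqrt_le_1_alt. lra.
Qed.

Lemma is_lim_sqrt_reg_derive (x : R) : x <> 0 ->
  is_lim_seq (fun N => sqrt_reg_derive (/ (INR N + 1)) x) (/ 2 * / sqrt (Rabs x)).
Proof.
  intros Hx. assert (0 < x ^ 2) by now apply pow2_gt_0.
  replace (/ 2 * / sqrt (Rabs x)) with (sqrt_reg_derive 0 x).
  - apply (is_lim_seq_continuous (fun e => sqrt_reg_derive e x) _ 0);
      [|apply is_lim_seq_inv_INR_S].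
    apply continuity_pt_filterlim.
    apply (continuous_comp_2 (fun e => e) (fun _ => x) sqrt_reg_derive);
      [apply continuous_id|apply continuous_const|].
    apply continuous_sqrt_reg_derive. lra.
  - unfold sqrt_reg_derive. rewrite !Rplus_0_r, sqrt_sqrt_pow2.
    pose proof (sqrt_lt_R0 _ (Rabs_pos_lt x Hx)). field. split; lra.
Qed.

(** * Lebesgue integration *)

From mathcomp Require Import all_boot all_order all_algebra.
From mathcomp Require Import all_classical all_reals all_analysis measurable_realfun.
From mathcomp Require Import Rstruct Rstruct_topology.
Import Order.TTheory GRing.Theory Num.Theory numFieldNormedType.Exports.

Section FatouIntegrable.
Local Open Scope classical_set_scope.
Local Open Scope ring_scope.
Local Open Scope ereal_scope.
Context d (T : measurableType d) (R : realType) (mu : {measure set T -> \bar R}).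

Lemma fatou_integrable (D : set T) (f_ : nat -> T -> \bar R) (f : T -> \bar R) (K : R) :
  measurable D -> (forall n, measurable_fun D (f_ n)) ->
  (forall n x, D x -> 0 <= f_ n x) -> (forall x, D x -> f_ ^~ x @ \oo --> f x) ->
  (forall n, \int[mu]_(x in D) f_ n x <= K%:E) -> mu.-integrable D f.
Proof.
move=> mD mf_ f_0 f_f f_K; apply/integrableP; split.
  exact: (emeasurable_fun_cvg f_).
rewrite (_ : \int[mu]_(x in D) `|f x| = \int[mu]_(x in D) limn_einf (f_ ^~ x)); last first.
  apply: eq_integral => x; rewrite inE => Dx.
  have [f_cvg f_lim] : cvgn (f_ ^~ x) /\ limn (f_ ^~ x) = f x.
    by split; [apply/cvg_ex; exists (f x) => /=; exact: f_f|exact/cvg_lim/f_f].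
  rewrite is_cvg_limn_einfE// f_lim gee0_abs// -f_lim.
  by apply: lime_ge => //; apply: nearW => n; exact: f_0.
apply: (le_lt_trans (fatou mu mD mf_ f_0)); apply: le_lt_trans (ltry K).
rewrite limn_einf_lim; apply: lime_le; first exact: is_cvg_einfs.
apply: nearW => n; apply: le_trans (f_K n); apply: ereal_inf_lbound.
by exists n => //=.
Qed.
End FatouIntegrable.

Section LebesgueInterval.
Local Open Scope classical_set_scope.
Local Open Scope ring_scope.
Context (R : realType).
Local Notation mu := (@lebesgue_measure R).

Lemma is_derive_diff_quotient (f : R -> R) (x l : R) :
  (forall e, 0 < e -> exists2 d, 0 < d &
     forall h, h != 0 -> `|h| < d -> `|(f (x + h) - f x) / h - l| < e) ->
  derive.is_derive x (1 : R^o) f l.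
Proof.
move=> fl.
have quotient_cvg : (fun h : R => h^-1 *: (f (h + x) - f x)) @ 0^' --> l.
  apply/cvgrPdist_lt => e /fl[d d0 dl]; near=> h.
  rewrite distrC [h^-1 *: _]mulrC (addrC h); apply: dl.
    by near: h; exact: nbhs_dnbhs_neq.
  by near: h; exact: dnbhs0_lt.
have quotientE : (fun h : R => h^-1 *: ((f \o shift x) (h *: 1) - f x)) =
    (fun h : R => h^-1 *: (f (h + x) - f x)).
  by apply/funext => h /=; rewrite [h *: 1]mulr1.
apply: DeriveDef; last by rewrite /derive quotientE; exact: cvg_lim quotient_cvg.
by apply/cvg_ex; exists l; rewrite quotientE.
Unshelve. all: by end_near. Qed.

Lemma integral_primitive (f F : R -> R) (a b : R) : a < b -> continuous f ->
  (forall x, derive.is_derive x (1 : R^o) F (f x)) ->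
  mu.-integrable `[a, b] (EFin \o f) /\
  (\int[mu]_(x in `[a, b]) (f x)%:E = (F b - F a)%:E)%E.
Proof.
move=> ab cf dF.
have cF x : F y @[y --> x] --> F x.
  by apply/differentiable_continuous; rewrite -derivable1_diffP; have [] := dF x.
split.
  apply: continuous_compact_integrable; first exact: segment_compact.
  exact: continuous_subspaceT.
rewrite EFinB; apply: (@continuous_FTC2 _ f F) => //.
- exact: continuous_subspaceT.
- split; [by move=> x _; have [] := dF x | exact/cvg_at_right_filter/cF
         | exact/cvg_at_left_filter/cF].
- by move=> x _; rewrite derive1E derive_val.
Qed.

Lemma integrable_setD1 (A : set R) (c : R) (f : R -> R) : measurable A ->
  mu.-integrable (A `\ c) (EFin \o f) -> mu.-integrable A (EFin \o f).
Proof.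
move=> mA fi; have mAc : measurable (A `\ c) by exact: measurableD.
apply/(@negligible_integrable _ _ _ mu A [set c]) => //.
- have /measurable_int mf := fi.
  have [Ac|Ac] := pselect (A c); last by rewrite -(not_setD1 Ac).
  rewrite -(setD1K Ac); apply/measurable_funU => //.
  by split => //; exact: measurable_fun_set1.
- exact: lebesgue_measure_set1.
Qed.

Lemma fatou_integrable_setD1 (A : set R) (c K : R) (f_ : nat -> R -> R) (f : R -> R) :
  measurable A -> (forall n, measurable_fun A (f_ n)) ->
  (forall n x, 0 <= f_ n x) -> (forall x, (A `\ c) x -> f_ ^~ x @ \oo --> f x) ->
  (forall n, \int[mu]_(x in A) (f_ n x)%:E <= K%:E)%E -> mu.-integrable (A `\ c) (EFin \o f).
Proof.
move=> mA mf_ f_0 f_f f_K.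
have mAc : measurable (A `\ c) by exact: measurableD.
have mf_c n : measurable_fun (A `\ c) (EFin \o f_ n).
  by apply/measurable_EFinP; apply: measurable_funS (mf_ n).
apply: (@fatou_integrable _ _ _ mu _ (fun n => EFin \o f_ n) _ K) => //.
- by move=> n x _; rewrite /= lee_fin.
- by move=> x Ax; apply: cvg_EFin; [exact: nearW|exact: f_f].
- by move=> n; rewrite (@integral_setD1 R (EFin \o f_ n) c A mAc (mf_c n)); exact: f_K.
Qed.

Lemma dominated_convergence_setD1 (A : set R) (c : R) (f_ : nat -> R -> R) (f g : R -> R)
    (v_ : nat -> R) (v : R) :
  measurable A -> (forall n, measurable_fun A (f_ n)) ->
  (forall x, (A `\ c) x -> f_ ^~ x @ \oo --> f x) ->
  mu.-integrable (A `\ c) (EFin \o g) ->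
  (forall n x, (A `\ c) x -> `|f_ n x| <= g x) ->
  (forall n, \int[mu]_(x in A) (f_ n x)%:E = (v_ n)%:E)%E -> v_ @ \oo --> v ->
  mu.-integrable A (EFin \o f) /\ (\int[mu]_(x in A) (f x)%:E = v%:E)%E.
Proof.
move=> mA mf_ f_f ig f_g f_v vv.
have mAc : measurable (A `\ c) by exact: measurableD.
have mf_c n : measurable_fun (A `\ c) (EFin \o f_ n).
  by apply/measurable_EFinP; apply: measurable_funS (mf_ n).
have cvg_f x : (A `\ c) x -> (EFin \o f_ ^~ x) @ \oo --> (f x)%:E.
  by move=> Ax; apply: cvg_EFin; [exact: nearW|exact: f_f].
have mf : measurable_fun (A `\ c) (EFin \o f).
  exact: (emeasurable_fun_cvg (fun n => EFin \o f_ n)).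
have [fi _ cvg_int] : [/\ mu.-integrable (A `\ c) (EFin \o f),
    [sequence \int[mu]_(x in A `\ c) `|(f_ n x)%:E - (f x)%:E|]_n @ \oo --> 0 &
    [sequence \int[mu]_(x in A `\ c) (f_ n x)%:E]_n @ \oo -->
      \int[mu]_(x in A `\ c) (f x)%:E]%E.
  apply: (@dominated_convergence _ _ _ mu (A `\ c) mAc
    (fun n => EFin \o f_ n) (EFin \o f) (EFin \o g)) => //.
  - by apply: aeW => x; exact: cvg_f.
  - by apply: aeW => x n Ax; rewrite lee_fin; exact: f_g.
split; first exact: integrable_setD1 fi.
rewrite -(@integral_setD1 R (EFin \o f) c A mAc mf).
apply: (cvg_unique _ cvg_int) => //=.
rewrite (_ : (fun n => _) = EFin \o v_); first by apply: cvg_EFin => //; exact: nearW.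
apply/funext => n /=; rewrite -f_v.
exact: (@integral_setD1 R (EFin \o f_ n) c A mAc (mf_c n)).
Qed.
End LebesgueInterval.

From Stdlib Require Import Reals.
From Coquelicot Require Import Coquelicot.
Local Notation mu := (@lebesgue_measure R).

Lemma continuous_Coquelicot (f : R -> R) :
  (forall t, continuous f t) -> forall x : R, continuous_at x f.
Proof. by move=> cf x; apply/continuity_pt_cvg; exact/continuity_pt_filterlim/cf. Qed.

Lemma is_lim_seq_cvg (u : nat -> R) (l : R) : is_lim_seq u l -> (u @ \oo --> l)%classic.
Proof.
move=> /is_lim_seq_Reals ul; apply/cvg_ballP => e /RltP /ul[N HN].
exists N => // n /= /ssrnat.leP Nn.
by have /RltP := HN n Nn; rewrite Rdist_sym RdistE.
Qed.

Lemma lebesgue_integral_is_derive (f F : R -> R) (a b : R) : (a < b)%R ->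
  (forall t, continuous f t) -> (forall t, is_derive F t (f t)) ->
  mu.-integrable `[a, b] (EFin \o f) /\
  (\int[mu]_(t in `[a, b]) (f t)%:E)%E = (F b - F a)%:E.
Proof.
move=> /RltP ab /continuous_Coquelicot cf dF.
apply: integral_primitive => // x; apply: is_derive_diff_quotient => e /RltP e0.
have /is_derive_Reals/(_ e e0)[delta dF_delta] := dF x.
exists (RIneq.pos delta); first by apply/RltP; exact: RIneq.cond_pos.
by move=> h /eqP h0; rewrite -!RabsE => /RltP hd; apply/RltP; exact: dF_delta.
Qed.

Lemma lebesgue_integral_is_RInt (f : R -> R) (a b v : R) : (a < b)%R ->
  (forall t, continuous f t) -> is_RInt f a b v ->
  mu.-integrable `[a, b] (EFin \o f) /\ (\int[mu]_(t in `[a, b]) (f t)%:E)%E = v%:E.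
Proof.
move=> ab cf fv.
have [fi ->] := lebesgue_integral_is_derive f (fun x => RInt f a x) a b ab cf
  (fun x => is_derive_RInt_continuous f a x cf).
split => //; congr EFin; rewrite (is_RInt_unique _ _ _ _ fv) RInt_point.
exact: Rminus_0_r.
Qed.

Lemma integrable_inv_sqrt_dist (a b c C : R) : (a < b)%R -> (0 <= C)%R ->
  mu.-integrable (`[a, b] `\ c)%classic (EFin \o (fun t => (C * / sqrt (Rabs (t - c)))%R)).
Proof.
move=> ab C0.
pose e N := (/ (INR N + 1))%R.
have e0 N : (0 < e N)%R by apply: Rinv_0_lt_compat; have := pos_INR N; lra.
pose f_ N t := (2 * C * sqrt_reg_derive (e N) (t - c))%R.
pose F_ N t := (2 * C * sqrt_reg (e N) (t - c))%R.
have cf_ N t : continuous (f_ N) t.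
  apply: (continuous_mult (fun=> (2 * C)%R)); first exact: continuous_const.
  apply: (continuous_comp_2 (fun=> e N) (fun t => (t - c)%R) sqrt_reg_derive).
  - exact: continuous_const.
  - by continuity_arith.
  - by apply: continuous_sqrt_reg_derive; have := pow2_ge_0 (t - c); have := e0 N; lra.
have dF_ N t : is_derive (F_ N) t (f_ N t).
  apply: is_derive_scal; rewrite -[X in is_derive _ _ X]Rmult_1_r.
  apply: (is_derive_comp_R (sqrt_reg (e N)) (fun t => (t - c)%R)).
    exact: is_derive_sqrt_reg.
  by auto_derive => //; lra.
pose K := (2 * C * (sqrt (Rabs (b - c)) + sqrt (Rabs (a - c))))%R.
apply: (@fatou_integrable_setD1 R `[a, b]%classic c K f_).
- exact: measurable_itv.
- move=> N; apply: measurable_funTS; apply: continuous_measurable_fun.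
  exact/continuous_Coquelicot/cf_.
- move=> N t; apply/RleP; apply: Rmult_le_pos; first by lra.
  exact/Rlt_le/sqrt_reg_derive_pos.
- move=> t [_ /= /Rminus_eq_contra tc]; apply: is_lim_seq_cvg.
  have -> : (C * / sqrt (Rabs (t - c)))%R = (2 * C * (/ 2 * / sqrt (Rabs (t - c))))%R.
    by field; apply: Rgt_not_eq; apply/sqrt_lt_R0/Rabs_pos_lt.
  apply: (is_lim_seq_scal_l _ (2 * C)%R (/ 2 * / sqrt (Rabs (t - c)))%R).
  exact: is_lim_sqrt_reg_derive.
- move=> N; have [_ ->] := lebesgue_integral_is_derive (f_ N) (F_ N) a b ab (cf_ N) (dF_ N).
  rewrite lee_fin; apply/RleP.
  have := Rabs_sqrt_reg_le (e N) (b - c) (e0 N); have := Rabs_sqrt_reg_le (e N) (a - c) (e0 N).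
  move=> /Rabs_le_between sa /Rabs_le_between sb; rewrite /F_ /K.
  by change (2 * C * sqrt_reg (e N) (b - c) - 2 * C * sqrt_reg (e N) (a - c) <=
    2 * C * (sqrt (Rabs (b - c)) + sqrt (Rabs (a - c))))%R; nra.
Qed.

Lemma lebesgue_integral_left_limit (f : R -> R -> R) (v : R -> R) (a b c d s C : R) :
  (a < b)%R -> (d < s)%R -> (0 <= C)%R ->
  (forall s' t, (d <= s' < s)%R -> continuous (f s') t) ->
  (forall s', (d <= s' < s)%R -> is_RInt (f s') a b (v s')) ->
  (forall s' t, (d <= s' < s)%R -> (a <= t <= b)%R -> t <> c ->
    (Rabs (f s' t) <= C * / sqrt (Rabs (t - c)))%R) ->
  (forall t, (a <= t <= b)%R -> t <> c -> continuous (fun s' => f s' t) s) -> continuous v s ->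
  mu.-integrable `[a, b] (EFin \o f s) /\ (\int[mu]_(t in `[a, b]) (f s t)%:E)%E = (v s)%:E.
Proof.
move=> ab ds C0 cf fv f_le cfs cv.
pose u N := (s - (s - d) * / (INR N + 1))%R.
have u_bounds N : (d <= u N < s)%R.
  rewrite /u; have N0 := pos_INR N.
  have inv0 : (0 < / (INR N + 1))%R by apply: Rinv_0_lt_compat; lra.
  have inv1 : (/ (INR N + 1) <= 1)%R by rewrite -Rinv_1; apply: Rinv_le_contravar; lra.
  by nra.
have u_lim : is_lim_seq u s.
  rewrite -{1}(Rminus_0_r s) -(Rmult_0_r (s - d)).
  apply: is_lim_seq_minus'; first exact: is_lim_seq_const.
  exact: (is_lim_seq_scal_l _ (s - d)%R 0%R is_lim_seq_inv_INR_S).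
have comp_lim (g : R -> R) : continuous g s -> (g \o u @ \oo --> g s)%classic.
  move=> cg; apply: is_lim_seq_cvg; apply: is_lim_seq_continuous u_lim.
  exact/continuity_pt_filterlim.
have in_itvP t : (`[a, b] `\ c)%classic t -> (a <= t <= b)%R /\ t <> c.
  by move=> [/=]; rewrite in_itv /= => /andP[/RleP a_t /RleP t_b].
apply: (@dominated_convergence_setD1 R `[a, b]%classic c (fun N => f (u N)) (f s)
  (fun t => (C * / sqrt (Rabs (t - c)))%R) (v \o u) (v s)).
- exact: measurable_itv.
- move=> N; apply: measurable_funTS; apply: continuous_measurable_fun.
  by apply: continuous_Coquelicot => t; exact: cf.
- by move=> t /in_itvP[t_ab tc]; apply: (comp_lim (fun s' => f s' t)); exact: cfs.
- exact: integrable_inv_sqrt_dist.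
- by move=> N t /in_itvP[t_ab tc]; rewrite -RabsE; apply/RleP; exact: f_le.
- move=> N; have [|_ ->//] :=
    lebesgue_integral_is_RInt (f (u N)) a b (v (u N)) ab _ (fv _ (u_bounds N)).
  by move=> t; exact: cf.
- exact: comp_lim.
Qed.

Lemma integral_kernel_integrand (m n : nat) (s s' t' : R) :
  (m <= n)%coq_nat -> (0 < s' <= s)%R -> (0 < t' < PI)%R ->
  mu.-integrable `[0%R, PI] (EFin \o kernel_integrand m n s s' t') /\
  (\int[mu]_(t in `[0%R, PI]) (kernel_integrand m n s s' t' t)%:E)%E =
  (closed_form m n s s' t')%:E.
Proof.
move=> mn [s'0 s's] t'_bounds.
have [s'_lt_s|s'_eq_s] := Rle_lt_or_eq_dec _ _ s's.
  apply: lebesgue_integral_is_RInt; first exact: PI_RGT_0.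
    by move=> t; apply: continuous_kernel_integrand.
  exact: is_RInt_kernel_integrand.
rewrite s'_eq_s in s'0 *.
have [C [C0 dominated]] := kernel_integrand_dominated m n s t' s'0 t'_bounds.
apply: (@lebesgue_integral_left_limit (fun s' => kernel_integrand m n s s' t')
  (fun s' => closed_form m n s s' t') 0%R PI t' (s / 2)%R s C) => //.
- exact: PI_RGT_0.
- by lra.
- by move=> r t r_bounds; apply: continuous_kernel_integrand; lra.
- by move=> r r_bounds; apply: is_RInt_kernel_integrand => //; lra.
- by move=> r t r_bounds; apply: dominated; lra.
- by move=> t t_bounds t_neq; exact: continuous_kernel_integrand_radius.
- exact: continuous_closed_form_radius.
Qed.

Lemma chi_sym (s s' t t' : R) : chi s s' t t' = chi s' s t t'.
Proof. by rewrite /chi; f_equal; ring. Qed.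

Theorem theorem3p3 (m n : nat) (s s' t' : R) :
  (m <= n)%coq_nat -> (0 < s)%R -> (0 < s')%R -> (0 < t')%R -> (t' < PI)%R ->
  let f := fun t : R =>
    (legQhalf m (chi s s' t t') * ferrersP m n (cos t) * sqrt (sin t))%R in
  (@lebesgue_measure R).-integrable `[0%R, PI] (EFin \o f) /\
  (\int[@lebesgue_measure R]_(t in `[0%R, PI]) (f t)%:E)%E =
  ((2 * PI * (-1) ^ m * INR (Factorial.fact (n - m)) / INR (Factorial.fact (n + m))
    * sqrt (sinh s * sinh s' * sin t')
    * ferrersP m n (cos t')
    * legP m n (cosh (Rmin s s')) * legQ m n (cosh (Rmax s s')))%R)%:E.
Proof.
move=> mn s0 s'0 t'0 t'pi f.
wlog s's : s s' s0 s'0 @f / (s' <= s)%R.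
  move=> ordered; have [s's|/Rnot_le_lt/Rlt_le ss'] := Rle_dec s' s; first exact: ordered.
  have fE : (fun t => (legQhalf m (chi s' s t t') * ferrersP m n (cos t) * sqrt (sin t))%R) = f.
    by apply/funext => t; rewrite /f chi_sym.
  rewrite -fE (Rmin_comm s) (Rmax_comm s) (Rmult_comm (sinh s)); exact: ordered.
have [f_int f_val] := integral_kernel_integrand m n s s' t' mn (conj s'0 s's) (conj t'0 t'pi).
have fE t : t \in `[0%R, PI]%classic -> kernel_integrand m n s s' t' t = f t.
  rewrite inE /= in_itv /= => /andP[/RleP t0 /RleP tpi].
  exact: kernel_integrand_legQhalf.
rewrite (Rmin_right s s') // (Rmax_left s s') //; split.
  by apply: eq_integrable f_int => // t t_in /=; rewrite fE.
by rewrite -[RHS]f_val; apply: eq_integral => t t_in; rewrite fE.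
Qed.
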